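(* Let $A$ be an infinite set of positive integers with $\gcd(A) = 1$. If $\alpha > 0$ is a real number and \[ \log p_A(n) \sim c_0\sqrt{\alpha n} = 2\sqrt{\frac{\pi^2\alpha n}{6}} \quad\text{as } n\to\infty, \] then $A$ has asymptotic density $\alpha$, i.e. $\lim_{x\to\infty} A(x)/x$ exists and equals $\alpha$.
   Context: For a set $A$ of positive integers, $A(x)$ denotes the number of elements of $A$ not exceeding $x$. If the limit $\lim_{x\to\infty} A(x)/x$ exists, it is called the asymptotic density of $A$. The greatest common divisor of all the elements of $A$ is denoted $\gcd(A)$. The partition function $p_A(n)$ counts the partitions of $n$ with parts in $A$, that is, representations of $n$ as a sum of not necessarily distinct elements of $A$ (any number of summands), where representations differing only in the order of the summands are identified; $p_A(0) = 1$. (Since $\gcd(A)=1$, $p_A(n)\ge 1$ for all sufficiently large $n$.) The constant is $c_0 = \pi\sqrt{2/3}$. The notation $f(n)\sim g(n)$ means $f(n)/g(n)\to 1$. *)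

(* Defs.v *)
From mathcomp Require Import all_boot all_order all_algebra finmap.
From mathcomp Require Import all_classical all_reals all_analysis.

Set Implicit Arguments.
Unset Strict Implicit.
Unset Printing Implicit Defensive.

Import Order.TTheory GRing.Theory Num.Theory.
Import numFieldNormedType.Exports.

Local Open Scope classical_set_scope.
Local Open Scope ring_scope.

Definition common_divisor (A : set nat) (d : nat) : Prop :=
  forall a, A a -> (d %| a)%N.

Definition is_gcd_of_set (A : set nat) (d : nat) : Prop :=
  common_divisor A d /\ forall e, common_divisor A e -> (e <= d)%N.

(* A partition is listed in nonincreasing order, so that rearrangements of the
   same summands are identified; the only partition of 0 is the empty list. *)
Definition partitions (A : set nat) (n : nat) : set (seq nat) :=
  [set s | [/\ sorted geq s, forall a, a \in s -> A a & sumn s = n]].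

(* [fset_set] is meaningful on finite sets only: see [finite_partitions]. *)
Definition partition_fun (A : set nat) (n : nat) : nat :=
  #|` fset_set (partitions A n)|%fset.

Definition counting_set (R : realType) (A : set nat) (x : R) : set nat :=
  [set a | A a /\ a%:R <= x].

(* The set is always finite: see [finite_counting_set]. *)
Definition counting_fun (R : realType) (A : set nat) (x : R) : nat :=
  #|` fset_set (counting_set A x)|%fset.

Definition has_asymptotic_density (R : realType) (A : set nat) (d : R) : Prop :=
  (counting_fun A x)%:R / x @[x --> +oo] --> d.

Definition asymp_equiv (R : realType) (f g : nat -> R) : Prop :=
  f n / g n @[n --> \oo] --> (1 : R).

Definition c0 (R : realType) : R := pi * Num.sqrt (2 / 3).

Lemma finite_partitions (A : set nat) (n : nat) :
  (forall a, A a -> (0 < a)%N) -> finite_set (partitions A n).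
Proof.
move=> Apos.
pose f (s : n.-bseq 'I_n.+1) : seq nat := map val (val s).
apply: (@sub_finite_set _ _ (f @` setT)); last first.
  exact/finite_image/finite_finset.
move=> s [_ sA sn].
have sz : (size s <= n)%N.
  rewrite -sn; elim: s sA {sn} => //= a s IH sA.
  rewrite -add1n; apply: leq_add; first by apply/Apos/sA; rewrite mem_head.
  by apply: IH => b bs; apply: sA; rewrite inE bs orbT.
have le_s a : a \in s -> (a < n.+1)%N.
  by move=> /rot_to[i s' E]; rewrite ltnS -sn -(sumn_rot s i) E /= leq_addr.
have fK : map val (map (@inord n) s) = s.
  rewrite -map_comp -[RHS]map_id; apply/eq_in_map => a /le_s an /=.
  by rewrite inordK.
have szm : (size (map (@inord n) s) <= n)%N by rewrite size_map.
by exists (Bseq szm).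
Qed.

Lemma finite_counting_set (R : realType) (A : set nat) (x : R) :
  finite_set (counting_set A x).
Proof.
apply: (@sub_finite_set _ _ `I_(Num.truncn x).+1); last exact: finite_II.
move=> a [_ ax]; rewrite /= ltnS truncn_ge_nat //.
exact: le_trans ax.
Qed.

Lemma partition_fun0 (A : set nat) :
  (forall a, A a -> (0 < a)%N) -> partition_fun A 0 = 1%N.
Proof.
move=> Apos; rewrite /partition_fun.
suff -> : partitions A 0 = [set [::]] by rewrite fset_set1 cardfs1.
apply/seteqP; split => [[//|a s] [_ sA /= /eqP]|s /= ->]; last by split.
by rewrite addn_eq0 gtn_eqF //; apply/Apos/sA; rewrite mem_head.
Qed.

(* Main.v *)
Require Import Defs.
From mathcomp Require Import all_boot all_order all_algebra finmap.
From mathcomp Require Import all_classical all_reals all_analysis.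
From mathcomp Require Import ring lra.

(** Write $b^2 = \alpha \pi^2 / 6$, so that the hypothesis reads
    $\log p_A(n) \sim 2 b \sqrt n$, and consider
    $F_A(t) = \sum_{a \in A} -\log(1 - e^{-at})$ for $t > 0$. By Euler's product,
    $F_A(t)$ is the logarithm of $\sum_n p_A(n) e^{-nt}$.

    The growth of $p_A$ gives $t F_A(t) \to b^2$ as $t \to 0^+$
    ([log_partition_abelian]): a single term of the generating function, with
    $n$ near $b^2/t^2$, bounds $F_A$ from below, and the inequality
    $2 b \sqrt n \le \theta n t + b^2 / (\theta t)$, summed against a geometric
    series, bounds it from above. When $A$ is the set of all positive integers
    the limit of $t F(t)$ is $\zeta(2) = \pi^2/6$ ([scaled_log_factor1], which
    rests on [basel]). Hence the bounded weights $w_n = 1_A(n) - \alpha$ satisfy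
    $t \sum_n w_n (-\log(1 - e^{-nt})) \to 0$, and two Tauberian steps turn this
    into $\frac1N \sum_{n \le N} w_n \to 0$, which is the claim.

    - From the logarithmic to the exponential kernel
      ([laplace_of_log_kernel]). Put $V(t) = t \sum_n w_n e^{-nt}$, a bounded
      function. Expanding the logarithm,
      $t \sum_n w_n (-\log(1 - e^{-nt})) = \sum_k V(kt)/k^2$. Because
      $\sum_{k \ge 2} 1/k^2 \le 3/4 < 1$, the term $k = 1$ dominates: any
      eventual bound for $|V|$ near 0 improves by a constant factor, and
      $V(t) \to 0$. This contraction stands in for Moebius inversion.

    - From Abel to Cesaro means ([bounded_tauber]). With $y = 2^{-n/N}$ the
      polynomial $1 - (1 - y^p)^{2^p}$ in $y$ is close to the indicator of
      $n \le N$: the error is at most $2^{-p|n-N|/N}$, whose sum over $n$ is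
      $O(N/p)$. The polynomial has no constant term, so its average against
      $w$ is a finite combination of values of $V$. *)

Set Implicit Arguments.
Unset Strict Implicit.
Unset Printing Implicit Defensive.

Import Order.TTheory GRing.Theory Num.Theory.
Import numFieldNormedType.Exports.

Local Open Scope classical_set_scope.
Local Open Scope ring_scope.

(** * Series of dilates of a kernel *)

Section dilates.
Context {R : realType}.
Implicit Types (w : nat -> R) (phi : R -> R) (t u y C : R).

(** The weight [w n] belongs to the positive integer [n.+1]: this indexing keeps
    the argument of the kernel away from 0. *)
Definition dilate_sum phi w t m := \sum_(n < m) w n * phi (n.+1%:R * t).
Definition dilate_series phi w t : R := limn (dilate_sum phi w t).

Definition expN u : R := expR (- u).

(** The logarithm of the Euler factor $(1 - e^{-u})^{-1}$. *)
Definition log_factor u : R := - ln (1 - expN u).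

Lemma expNM n t : expN (n%:R * t) = expN t ^+ n.
Proof. by rewrite /expN -mulrN expRM_natl. Qed.

Lemma expN_gt0 t : 0 < expN t.
Proof. exact: expR_gt0. Qed.

Lemma expN_lt1 t : 0 < t -> expN t < 1.
Proof. by move=> t0; rewrite /expN expR_lt1 oppr_lt0. Qed.

Lemma sum_geom_le y m : 0 <= y < 1 -> \sum_(n < m) y ^+ n.+1 <= y / (1 - y).
Proof.
move=> /andP[y0 y1]; have y1' : 0 < 1 - y by rewrite subr_gt0.
under eq_bigr do rewrite exprS.
rewrite -mulr_sumr ler_wpM2l// -[leRHS]mul1r ler_pdivlMr// mulrC.
rewrite -[1 - y]opprB mulNr -subrX1 opprB gerBl; exact: exprn_ge0.
Qed.

(** The sum is at most $1/(e^t - 1)$, and $e^t - 1 \ge t$. This uniform bound is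
    what makes the rescaled Laplace sum of bounded weights bounded near 0. *)
Lemma scaled_geom_le1 t m : 0 < t -> t * \sum_(n < m) expN (n.+1%:R * t) <= 1.
Proof.
move=> t0; under eq_bigr do rewrite expNM.
have y0 := expN_gt0 t; have y1 := expN_lt1 t0.
apply: (@le_trans _ _ (t * (expN t / (1 - expN t)))).
  apply: ler_wpM2l; [exact: ltW|]; apply: sum_geom_le; rewrite y1 ltW//.
rewrite mulrA ler_pdivrMr ?subr_gt0// mul1r lerBrDr.
rewrite -{2}[expN t]mul1r -mulrDl /expN expRN ler_pdivrMr ?expR_gt0// mul1r.
by rewrite addrC expR_ge1Dx.
Qed.

Lemma is_cvg_dilate phi w t C (D : R) : 0 < t -> (forall n, `|w n| <= C) ->
    (forall n, `|phi (n.+1%:R * t)| <= D * expN t ^+ n.+1) ->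
  cvgn (dilate_sum phi w t).
Proof.
move=> t0 wC phiD.
have C0 : 0 <= C by apply: le_trans (wC 0%N).
have D0 : 0 <= D.
  have := le_trans (normr_ge0 _) (phiD 0%N).
  by rewrite pmulr_lge0// exprn_gt0// expN_gt0.
have -> : dilate_sum phi w t = series (fun n => w n * phi (n.+1%:R * t)).
  by rewrite seriesEord.
apply: normed_cvg.
apply: (@series_le_cvg _ _ (geometric (C * D * expN t) (expN t))) => //=.
- by move=> n; rewrite !mulr_ge0// ?exprn_ge0// ltW// expN_gt0.
- move=> n; rewrite normrM -!mulrA -exprS.
  by apply: ler_pM.
- apply: is_cvg_geometric_series.
  by rewrite ger0_norm ?expN_lt1// ltW ?expN_gt0.
Qed.

Lemma is_cvg_dilate_expN w t C : 0 < t -> (forall n, `|w n| <= C) ->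
  cvgn (dilate_sum expN w t).
Proof.
move=> t0 wC; apply: (@is_cvg_dilate _ _ _ C 1) => // n.
by rewrite mul1r -expNM ger0_norm// ltW ?expN_gt0.
Qed.

Lemma log_factor_ge0 u : 0 < u -> 0 <= log_factor u.
Proof.
move=> u0; rewrite /log_factor oppr_ge0 ln_le0// gerBl ltW//; exact: expN_gt0.
Qed.

Lemma log_factor_le u : 0 < u -> log_factor u <= expN u / (1 - expN u).
Proof.
move=> u0; have y0 := expN_gt0 u; have y1 : 0 < 1 - expN u.
  by rewrite subr_gt0 expN_lt1.
rewrite /log_factor -lnV ?posrE//.
have {1}-> : (1 - expN u)^-1 = 1 + expN u / (1 - expN u).
  by field; rewrite gt_eqF.
by apply: le_ln1Dx; apply: lt_le_trans (_ : 0 <= _); rewrite ?ltrN10 ?divr_ge0 ?ltW.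
Qed.

Lemma is_cvg_dilate_log_factor w t C : 0 < t -> (forall n, `|w n| <= C) ->
  cvgn (dilate_sum log_factor w t).
Proof.
move=> t0 wC; apply: (@is_cvg_dilate _ _ _ C (1 - expN t)^-1) => // n.
have y0 := expN_gt0 t; have y1 := expN_lt1 t0.
have nt0 : 0 < n.+1%:R * t by rewrite mulr_gt0.
rewrite ger0_norm ?log_factor_ge0// (le_trans (log_factor_le nt0))// expNM mulrC.
apply: ler_wpM2r; first by rewrite exprn_ge0// ltW.
have yn : expN t ^+ n.+1 <= expN t.
  by rewrite exprS ler_piMr ?exprn_ile1// ltW.
by rewrite lef_pV2 ?posrE ?subr_gt0 ?(le_lt_trans yn)// lerD2l lerN2.
Qed.

(** The remainder [h K] of the expansion vanishes at 0 and has derivative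
    $x^K/(1-x)$, so the mean value theorem bounds it by a multiple of $y^K$. *)
Lemma cvg_log_series y : 0 <= y < 1 ->
  \sum_(k < K) y ^+ k.+1 / k.+1%:R @[K --> \oo] --> - ln (1 - y).
Proof.
move=> /andP[y0 y1]; have y1' : 0 < 1 - y by rewrite subr_gt0.
have [->|yn0] := eqVneq y 0.
  rewrite subr0 ln1 oppr0; under eq_fun do
    (rewrite big1; last by move=> i _; rewrite expr0n/= mul0r); exact: cvg_cst.
have {yn0}y0 : 0 < y by rewrite lt_neqAle eq_sym yn0.
pose h (K : nat) (x : R) : R := - ln (1 - x) - \sum_(k < K) x ^+ k.+1 / k.+1%:R.
pose dh (K : nat) (x : R) : R := x ^+ K / (1 - x).
have dh_h (K : nat) (x : R) : 0 <= x < 1 -> is_derive x 1 (h K) (dh K x).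
  move=> /andP[x0 x1].
  have x1' : 0 < 1 - x by rewrite subr_gt0.
  elim: K => [|K IH].
    have -> : h 0%N = (fun z => - ln (1 - z)).
      by apply/funext => z; rewrite /h big_ord0 subr0.
    rewrite /dh expr0 div1r.
    have d1 : is_derive x 1 (fun z : R => 1 - z) (- 1).
      by apply: is_derive_eq; rewrite add0r mul1r.
    have d2 : is_derive (1 - x) 1 (@ln R) (1 - x)^-1 by exact: is_derive1_ln.
    have d3 := @is_derive1_comp _ (@ln R) (fun z => 1 - z) x _ _ d2 d1.
    have := is_deriveN d3; by rewrite mulrN1 opprK.
  have -> : h K.+1 = (fun z => h K z - (K.+1%:R)^-1 * z ^+ K.+1).
    by apply/funext => z; rewrite /h big_ord_recr/= opprD addrA [_^-1 * _]mulrC.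
  have dX : is_derive x 1 (fun z : R => K.+1%:R^-1 * z ^+ K.+1) (x ^+ K).
    have idX := @is_deriveX R R id K.+1 x 1 1 (is_derive_id x 1).
    have := is_deriveZ (K.+1%:R^-1) idX.
    have -> : K.+1%:R^-1 \*: (id ^+ K.+1) = (fun z : R => K.+1%:R^-1 * z ^+ K.+1).
      by apply/funext => z; rewrite /= exprfctE.
    by congr is_derive; rewrite /= /GRing.scale/= mulr1 mulrA mulVf// mul1r.
  have := is_deriveB IH dX; congr is_derive.
  by rewrite /dh exprS; field; rewrite gt_eqF.
have hy K : `|h K y| <= y ^+ K / (1 - y) * y.
  have [||c] := @MVT _ (h K) (dh K) 0 y y0.
  - by move=> x; rewrite in_itv/= => /andP[x0 xy]; apply: dh_h; rewrite ltW//= (lt_trans xy).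
  - apply: derivable_within_continuous => x; rewrite in_itv/= => /andP[x0 xy].
    by have [] := dh_h K x; rewrite ?x0 ?(le_lt_trans xy).
  rewrite in_itv/= => /andP[c0 cy].
  have -> : h K 0 = 0.
    by rewrite /h subr0 ln1 oppr0 big1 ?subr0// => i _; rewrite expr0n/= mul0r.
  rewrite !subr0 => ->.
  have c1 : 0 < 1 - c by rewrite subr_gt0 (lt_trans cy).
  rewrite ger0_norm /dh ?mulr_ge0 ?exprn_ge0 ?invr_ge0 ?(ltW c0) ?(ltW y0) ?(ltW c1)//.
  rewrite ler_wpM2r ?(ltW y0)//; apply: ler_pM; rewrite ?exprn_ge0 ?invr_ge0 ?(ltW c0) ?(ltW c1)//.
    by apply: lerXn2r; rewrite ?nnegrE ?(ltW c0) ?(ltW y0) ?(ltW cy).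
  by rewrite lef_pV2 ?posrE// lerD2l lerN2 ltW.
have hy0 : h K y @[K --> \oo] --> 0.
  apply: norm_cvg0.
  apply: (@squeeze_cvgr _ _ _ _ (cst 0) (fun K => y ^+ K / (1 - y) * y)).
  - by apply: nearW => K; rewrite normr_ge0 hy.
  - exact: cvg_cst.
  - rewrite -[X in _ --> X](mul0r y) -[X in _ --> X * y](mul0r (1 - y)^-1).
    by apply: cvgMr_tmp; apply: cvgMr_tmp; apply: cvg_expr; rewrite ger0_norm ?ltW.
have -> : (fun K => \sum_(k < K) y ^+ k.+1 / k.+1%:R) = (fun K => - ln (1 - y) - h K y).
  by apply/funext => K; rewrite /h opprB addrC subrK.
rewrite -[X in _ --> X]subr0; apply: cvgB => //; exact: cvg_cst.
Qed.
End dilates.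

(** * Expanding the logarithmic kernel *)

Section logker.
Context {R : realType}.
Implicit Types (w : nat -> R) (phi : R -> R) (t u y C : R).

Lemma cvg_sumr n (f : nat -> nat -> R) (l : nat -> R) :
  (forall i, f i m @[m --> \oo] --> l i) ->
  \sum_(i < n) f i m @[m --> \oo] --> \sum_(i < n) l i.
Proof. by move=> fl; apply: cvg_big => //; exact: add_continuous. Qed.

Lemma scaled_dilate_sum_expN_le w t C m : 0 < t -> (forall n, `|w n| <= C) ->
  `|t * dilate_sum expN w t m| <= C.
Proof.
move=> t0 wC; have C0 : 0 <= C by apply: le_trans (wC 0%N).
rewrite normrM gtr0_norm// /dilate_sum.
apply: (@le_trans _ _ (C * (t * \sum_(n < m) expN (n.+1%:R * t)))); last first.
  by rewrite -[leRHS]mulr1 ler_wpM2l// scaled_geom_le1.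
rewrite mulrCA ler_wpM2l ?(ltW t0)// mulr_sumr.
apply: le_trans (ler_norm_sum _ _ _) _; apply: ler_sum => i _.
by rewrite normrM (gtr0_norm (expN_gt0 _)) ler_wpM2r// ltW// expN_gt0.
Qed.

Lemma scaled_laplace_le w t C : 0 < t -> (forall n, `|w n| <= C) ->
  `|t * dilate_series expN w t| <= C.
Proof.
move=> t0 wC.
have cv : `|t * dilate_sum expN w t m| @[m --> \oo] --> `|t * dilate_series expN w t|.
  by apply: cvg_norm; apply: cvgMl_tmp; exact: is_cvg_dilate_expN wC.
by apply: cvgr_to_le cv _; apply: nearW => m; exact: scaled_dilate_sum_expN_le.
Qed.

(** Telescoping, from $1/(a+1)^2 \le 1/a - 1/(a+1)$. *)
Lemma sum_invsqr_tail K M :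
  \sum_(K.+1 <= k < K.+1 + M) (k.+1%:R ^+ 2)^-1 <= (K.+1%:R)^-1 - ((K.+1 + M)%:R)^-1 :> R.
Proof.
elim: M => [|M IH]; first by rewrite addn0 big_geq// subrr.
rewrite addnS big_nat_recr/= ?leq_addr//.
apply: (le_trans (lerD IH (lexx _))).
set a : R := (K.+1 + M)%:R.
have a0 : 0 < a by rewrite ltr0n addSn.
have -> : (K.+1 + M).+1%:R = a + 1 by rewrite -natr1.
rewrite -addrA lerD2l -lerBrDl opprK [leRHS]addrC.
have -> : a^-1 - (a + 1)^-1 = (a * (a + 1))^-1.
  by field; rewrite !gt_eqF// ltr_wpDr.
rewrite lef_pV2 ?posrE ?exprn_gt0 ?mulr_gt0 ?ltr_wpDr//.
by rewrite expr2 ler_wpM2r ?lerDl// ltW// ltr_wpDr.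
Qed.

(** After exchanging the two finite sums, the $k$-th power of the expansion
    contributes $V(kt)/k^2$, where $V(s) = s \sum_n w_n e^{-ns}$ is bounded by $C$.
    Only the terms $k > K+1$ survive in the difference, and they add up to at
    most $C \sum_{k > K+1} 1/k^2$. Keeping everything finite makes the exchange
    of sums free; both limits are taken in the next lemma. *)
Lemma scaled_log_factor_sum w t C m K M : 0 < t -> (forall n, `|w n| <= C) ->
  `|t * (\sum_(n < m) w n * (\sum_(k < K.+1 + M) expN (n.+1%:R * t) ^+ k.+1 / k.+1%:R))
   - \sum_(k < K.+1) (k.+1%:R * t * dilate_sum expN w (k.+1%:R * t) m) / k.+1%:R ^+ 2|
   <= C / K.+1%:R.
Proof.
move=> t0 wC; have C0 : 0 <= C by apply: le_trans (wC 0%N).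
pose g k := (k.+1%:R * t * dilate_sum expN w (k.+1%:R * t) m) / k.+1%:R ^+ 2.
have -> : t * (\sum_(n < m) w n * (\sum_(k < K.+1 + M) expN (n.+1%:R * t) ^+ k.+1 / k.+1%:R))
  = \sum_(0 <= k < K.+1 + M) g k.
  under eq_bigr do rewrite mulr_sumr.
  rewrite exchange_big/= mulr_sumr big_mkord; apply: eq_bigr => k _.
  rewrite /g /dilate_sum [_ * _ * \sum_(_ < _) _]mulrC !mulr_suml mulr_sumr.
  apply: eq_bigr => n _.
  have -> : expN (n.+1%:R * t) ^+ k.+1 = expN (n.+1%:R * (k.+1%:R * t)).
    by rewrite -expNM mulrCA.
  set e := expN _; field.
  by rewrite addrC natr1.
rewrite -(big_mkord xpredT g) (@big_cat_nat _ _ _ K.+1)//= ?leq_addr// addrAC subrr add0r.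
apply: le_trans (ler_norm_sum _ _ _) _.
apply: (@le_trans _ _ (\sum_(K.+1 <= k < K.+1 + M) C * (k.+1%:R ^+ 2)^-1)).
  apply: ler_sum => k _; rewrite /g normrM.
  rewrite [X in _ * X]ger0_norm ?invr_ge0 ?exprn_ge0//.
  rewrite ler_wpM2r ?invr_ge0 ?exprn_ge0//.
  by apply: scaled_dilate_sum_expN_le => //; rewrite mulr_gt0.
rewrite -mulr_sumr; apply: ler_wpM2l => //.
by apply: le_trans (sum_invsqr_tail _ _) _; rewrite gerBl.
Qed.

(** Letting first the length of the expansion, then the number of weights tend
    to infinity in [scaled_log_factor_sum]. *)
Lemma scaled_log_factor_approx w t C K : 0 < t -> (forall n, `|w n| <= C) ->
  `|t * dilate_series log_factor w t
   - \sum_(k < K.+1) (k.+1%:R * t * dilate_series expN w (k.+1%:R * t)) / k.+1%:R ^+ 2|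
   <= C / K.+1%:R.
Proof.
move=> t0 wC.
have step1 m : `|t * dilate_sum log_factor w t m
   - \sum_(k < K.+1) (k.+1%:R * t * dilate_sum expN w (k.+1%:R * t) m) / k.+1%:R ^+ 2|
   <= C / K.+1%:R.
  set S := \sum_(k < K.+1) _.
  have cv : `|t * (\sum_(n < m) w n *
      (\sum_(k < K.+1 + M) expN (n.+1%:R * t) ^+ k.+1 / k.+1%:R)) - S|
      @[M --> \oo] --> `|t * dilate_sum log_factor w t m - S|.
    apply: cvg_norm; apply: cvgB; last exact: cvg_cst.
    apply: cvgMl_tmp; apply: (cvg_sumr (f := fun n M =>
      w n * (\sum_(k < K.+1 + M) expN (n.+1%:R * t) ^+ k.+1 / k.+1%:R))
      (l := fun n => w n * log_factor (n.+1%:R * t))) => n; apply: cvgMl_tmp.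
    have nt0 : 0 < n.+1%:R * t by rewrite mulr_gt0.
    have := @cvg_log_series R (expN (n.+1%:R * t)).
    rewrite (ltW (expN_gt0 _)) expN_lt1// => /(_ isT).
    rewrite -(cvg_shiftn K.+1).
    under eq_fun do rewrite addnC; exact.
  by apply: cvgr_to_le cv _; apply: nearW => M; exact: scaled_log_factor_sum.
suff cv : `|t * dilate_sum log_factor w t m
   - \sum_(k < K.+1) (k.+1%:R * t * dilate_sum expN w (k.+1%:R * t) m) / k.+1%:R ^+ 2|
   @[m --> \oo] --> `|t * dilate_series log_factor w t
   - \sum_(k < K.+1) (k.+1%:R * t * dilate_series expN w (k.+1%:R * t)) / k.+1%:R ^+ 2|.
  by apply: cvgr_to_le cv _; apply: nearW.
apply: cvg_norm; apply: cvgB.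
  by apply: cvgMl_tmp; exact: is_cvg_dilate_log_factor wC.
apply: (cvg_sumr (f := fun k m =>
    k.+1%:R * t * dilate_sum expN w (k.+1%:R * t) m / k.+1%:R ^+ 2)
  (l := fun k => k.+1%:R * t * dilate_series expN w (k.+1%:R * t) / k.+1%:R ^+ 2)) => k.
apply: cvgMr_tmp; apply: cvgMl_tmp; apply: is_cvg_dilate_expN wC.
by rewrite mulr_gt0.
Qed.

End logker.

(** * From the logarithmic to the exponential kernel *)

Section contraction.
Context {R : realType}.

Lemma near_right0P (P : R -> Prop) :
  (\forall t \near 0^'+, P t) <-> exists2 d, 0 < d & forall t, 0 < t < d -> P t.
Proof.
split=> [|[d d0 dP]].
  rewrite near_withinE => /nbhs_ballP[d /= d0 dP]; exists d => // t /andP[t0 td].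
  by apply: dP => //; rewrite /ball/= sub0r normrN gtr0_norm.
near=> t; apply: dP; apply/andP; split; near: t.
- exact: nbhs_right_gt.
- exact: nbhs_right_lt.
Unshelve. all: by end_near. Qed.

(** $1/4$ from the first term and $1/2$ from the telescoping bound on the rest.
    All that matters is that the value is less than 1. *)
Lemma sum_invsqr_from2_le K :
  \sum_(1 <= k < K.+1) (k.+1%:R ^+ 2)^-1 <= 3 / 4 :> R.
Proof.
case: K => [|K]; first by rewrite big_geq// divr_ge0.
rewrite big_ltn// -[K.+2]/(2 + K)%N; apply: le_trans (lerD (lexx _) (sum_invsqr_tail _ _)) _.
have : 0 <= ((2 + K)%:R)^-1 :> R by rewrite invr_ge0.
set a := (_ + K)%:R^-1; lra.
Qed.

Lemma exists_inv_small (C e : R) : 0 < e -> exists K, C / K.+1%:R <= e.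
Proof.
move=> e0; exists (Num.truncn (C / e)).
by rewrite ler_pdivrMr// mulrC -ler_pdivrMr// ltW// truncnS_gt.
Qed.

(** If $L(t)$ is approximately $\sum_k V(kt)/k^2$, then $V(t)$ is $L(t)$ minus the
    terms $k \ge 2$, whose weights add up to at most $3/4$. So a bound $M$ for
    $|V|$ near 0 improves to $3M/4$ plus small errors, and iterating drives
    $V$ to 0. *)
Lemma sqr_weighted_contraction (V L : R -> R) (C : R) : 0 < C ->
  (forall t, 0 < t -> `|V t| <= C) ->
  (forall t K, 0 < t ->
    `|L t - \sum_(k < K.+1) V (k.+1%:R * t) / k.+1%:R ^+ 2| <= C / K.+1%:R) ->
  L t @[t --> 0^'+] --> 0 -> V t @[t --> 0^'+] --> 0.
Proof.
move=> C0 VC VL L0.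
(* 7/8 leaves room, beyond 3/4, for two errors of M/16: one for the size of L
   and one for truncating the series. *)
have step M : 0 < M -> (\forall t \near 0^'+, `|V t| <= M) ->
    \forall t \near 0^'+, `|V t| <= 7 / 8 * M.
  move=> M0 /near_right0P[d d0 dM].
  have M16 : 0 < M / 16 by rewrite divr_gt0.
  have [K CK] := exists_inv_small C M16.
  have /cvgr0Pnorm_le/(_ _ M16)/near_right0P[d1 d10 d1M] := L0.
  apply/near_right0P; exists (Num.min (d / K.+1%:R) d1).
    by rewrite lt_min d10 divr_gt0.
  move=> t /andP[t0]; rewrite lt_min => /andP[td td1].
  have := le_trans (VL t K t0) CK.
  rewrite big_ord_recl/= mul1r expr1n divr1.
  set S := \sum_(_ < _) _.
  have SM : `|S| <= 3 / 4 * M.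
    apply: le_trans (ler_norm_sum _ _ _) _.
    apply: (@le_trans _ _ (\sum_(1 <= k < K.+1) M * (k.+1%:R ^+ 2)^-1)); last first.
      by rewrite -mulr_sumr mulrC ler_wpM2r ?(ltW M0)// sum_invsqr_from2_le.
    rewrite big_add1/= big_mkord; apply: ler_sum => k _.
    rewrite normrM [X in _ * X]ger0_norm ?invr_ge0 ?exprn_ge0//.
    rewrite ler_wpM2r ?invr_ge0 ?exprn_ge0//; apply: dM.
    rewrite mulr_gt0//= mulrC -ltr_pdivlMr//; apply: lt_le_trans td _.
    by rewrite ler_pM2l// lef_pV2 ?posrE// ler_nat; have := ltn_ord k.
  have LM : `|L t| <= M / 16 by apply: d1M; rewrite t0.
  move: LM SM; rewrite !ler_norml => /andP[? ?] /andP[? ?] /andP[? ?].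
  by apply/andP; split; lra.
have iter j : \forall t \near 0^'+, `|V t| <= (7 / 8) ^+ j * C.
  elim: j => [|j IH].
    by apply/near_right0P; exists 1 => // t /andP[t0 _]; rewrite expr0 mul1r VC.
  by rewrite exprS -mulrA; apply: step => //; rewrite mulr_gt0// exprn_gt0// divr_gt0.
apply/cvgr0Pnorm_le => e e0.
have [j je] : exists j, (7 / 8) ^+ j * C <= e.
  have : (7 / 8) ^+ j * C @[j --> \oo] --> (0 : R).
    rewrite -[X in _ --> X](mul0r C); apply: cvgMr_tmp; apply: cvg_expr.
    by rewrite ger0_norm ?divr_ge0// ltr_pdivrMr// mul1r ltr_nat.
  move=> /cvgr_le /(_ e e0) [j _ /(_ j (leqnn j))] ?; by exists j.
by apply: filterS (iter j) => t /le_trans; apply.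
Qed.

Lemma laplace_of_log_kernel (w : nat -> R) (C : R) : 0 < C -> (forall n, `|w n| <= C) ->
  t * dilate_series log_factor w t @[t --> 0^'+] --> 0 ->
  t * dilate_series expN w t @[t --> 0^'+] --> 0.
Proof.
move=> C0 wC.
apply: (@sqr_weighted_contraction (fun t => t * dilate_series expN w t) _ C) => //.
- by move=> t t0; exact: scaled_laplace_le.
- by move=> t K t0; exact: scaled_log_factor_approx.
Qed.

End contraction.

(** * From Abel to Cesaro means of a bounded sequence *)

Section tauber.
Context {R : realType}.
Implicit Types (w : nat -> R) (z C : R).

(** From $1 - z \le e^{-z}$ and $qz \le e^{qz}$. With $q = 2^p$ and $z = y^p$ this
    controls the cutoff on the side $y \ge 1/2$, and [bernoulli_compl] controls
    it on the side $y \le 1/2$. *)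
Lemma exprB1_le z q : 0 < z <= 1 -> (1 - z) ^+ q * (q%:R * z) <= 1.
Proof.
move=> /andP[z0 z1].
apply: (@le_trans _ _ (expR (- z) ^+ q * expR (q%:R * z))).
  apply: ler_pM; rewrite ?exprn_ge0 ?subr_ge0 ?mulr_ge0 ?(ltW z0)//.
    by apply: lerXn2r; rewrite ?nnegrE ?subr_ge0 ?expR_ge0//; apply: expR_ge1Dx.
  by apply: le_trans (expR_ge1Dx _); rewrite lerDr.
by rewrite -expRM_natl -expRD mulrN addNr expR0.
Qed.

Lemma bernoulli_compl z q : 0 <= z <= 1 -> 1 - (1 - z) ^+ q <= q%:R * z.
Proof.
move=> /andP[z0 z1]; elim: q => [|q IH]; first by rewrite expr0 subrr mul0r.
have : (1 - z) ^+ q <= 1 by rewrite exprn_ile1 ?subr_ge0 ?gerBl.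
have : 0 <= (1 - z) ^+ q by rewrite exprn_ge0 ?subr_ge0.
rewrite exprS -natr1; set P := _ ^+ q in IH *; nra.
Qed.

(** There is no constant term: a constant would contribute $\sum_n w_n$, which
    has no reason to converge. *)
Lemma smooth_cutoff_polyE q : exists c : nat -> R, forall z,
  1 - (1 - z) ^+ q = \sum_(i < q) c i * z ^+ i.+1.
Proof.
exists (fun i => - ((-1) ^+ i.+1 * 'C(q, i.+1)%:R)) => z.
rewrite addrC exprDn big_ord_recl/= expr0 bin0 mulr1n subn0 expr1n mulr1.
rewrite opprD addrAC addNr add0r -sumrN; apply: eq_bigr => i _.
rewrite expr1n mul1r (exprNn z) /bump/= add1n -mulr_natr.
by rewrite mulNr mulrAC.
Qed.

Lemma sum_expr_le (r : R) m : 0 <= r < 1 -> \sum_(i < m) r ^+ i <= (1 - r)^-1.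
Proof.
move=> /andP[r0 r1]; have r1' : 0 < 1 - r by rewrite subr_gt0.
rewrite -[leRHS]mul1r ler_pdivlMr// mulrC.
by rewrite -[1 - r]opprB mulNr -subrX1 opprB gerBl exprn_ge0.
Qed.

(** A restatement of $e^s \ge 1 + s$. *)
Lemma inv_subexpN_le (s : R) : 0 < s -> (1 - expN s)^-1 <= 1 + s^-1.
Proof.
move=> s0; have y1 := expN_lt1 s0.
have e1 : expN s * (1 + s) <= 1.
  rewrite /expN expRN mulrC ler_pdivrMr ?expR_gt0// mul1r; exact: expR_ge1Dx.
rewrite -[leLHS]mul1r ler_pdivrMr ?subr_gt0// -(ler_pM2r s0) mul1r.
have -> : (1 + s^-1) * (1 - expN s) * s = (s + 1) * (1 - expN s).
  by field; rewrite gt_eqF.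
lra.
Qed.

(** With $y = 2^{-(n+1)/N}$ this is $1 - (1 - y^p)^{2^p}$, a smooth substitute for
    the indicator of $n + 1 \le N$: the quantity $2^p y^p = 2^{p(1 - (n+1)/N)}$ is
    large when $n + 1 < N$ and small when $n + 1 > N$. *)
Definition smooth_cutoff (p N n : nat) : R :=
  1 - (1 - expN (n.+1%:R * (ln 2 / N%:R)) ^+ p) ^+ (2 ^ p).

(** Put $z = y^p$ and $q = 2^p$. Then $qz = r^{n+1-N}$; below $N$ the error
    $(1-z)^q$ is at most $1/(qz)$, above $N$ the value $1-(1-z)^q$ is at most $qz$. *)
Lemma smooth_cutoff_err (p N n : nat) (r := expN (p%:R * (ln 2 / N%:R))) : (0 < N)%N ->
  ((n < N)%N -> `|1 - smooth_cutoff p N n| <= r ^+ (N - n.+1)) /\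
  ((N <= n)%N -> `|smooth_cutoff p N n| <= r ^+ (n - N)).
Proof.
move=> N0; rewrite /smooth_cutoff.
set t : R := ln 2 / N%:R.
have N0' : 0 < N%:R :> R by rewrite ltr0n.
have t0 : 0 < t by rewrite divr_gt0// ln_gt0// ltr1n.
set z := _ ^+ p.
have z0 : 0 < z by rewrite exprn_gt0// expN_gt0.
have z1 : z <= 1 by rewrite exprn_ile1 ?(ltW (expN_gt0 _)) ?(ltW (expN_lt1 _))// mulr_gt0.
have r0 : 0 < r by exact: expN_gt0.
have r1 : r <= 1.
  by rewrite /r /expN expR_le1 oppr_le0 mulr_ge0// ltW.
have qz : (2 ^ p)%:R * z = expR (p%:R * t * (N%:R - n.+1%:R)).
  have -> : (2 ^ p)%:R = expR (p%:R * ln 2) :> R.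
    by rewrite natrX expRM_natl lnK// posrE.
  rewrite /z /expN -expRM_natl -expRD; congr expR.
  rewrite /t; field; by rewrite gt_eqF.
split=> nN.
  rewrite opprB addrC subrK ger0_norm ?exprn_ge0 ?subr_ge0//.
  have := @exprB1_le z (2 ^ p); rewrite z0 z1 qz => /(_ isT).
  rewrite -ler_pdivlMr ?expR_gt0// => /le_trans; apply.
  rewrite /r /expN -expRM_natl div1r -expRN ler_expR.
  rewrite natrB//.
  by rewrite mulrN mulrC lexx.
rewrite ger0_norm ?subr_ge0 ?exprn_ile1 ?subr_ge0 ?gerBl ?(ltW z0)//.
have := @bernoulli_compl z (2 ^ p); rewrite (ltW z0) z1 qz => /(_ isT)/le_trans; apply.
rewrite /r /expN -expRM_natl ler_expR natrB//.
have : 0 <= p%:R * t by rewrite mulr_ge0// ltW.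
by rewrite -/t -natr1; set P := p%:R * t; nra.
Qed.

(** On each side of $N$ the errors form a geometric series of ratio
    $r = 2^{-p/N}$, and $1/(1-r) \le 1 + N/(p \log 2)$. *)
Lemma smooth_cutoff_sum_err w C (p N m : nat) : (0 < N <= m)%N -> (0 < p)%N ->
  (forall n, `|w n| <= C) ->
  `|\sum_(n < N) w n - \sum_(n < m) w n * smooth_cutoff p N n|
  <= 2 * C * (1 + N%:R / (p%:R * ln 2)).
Proof.
move=> /andP[N0 Nm] p0 wC; have C0 : 0 <= C by apply: le_trans (wC 0%N).
pose r : R := expN (p%:R * (ln 2 / N%:R)).
have ln20 : 0 < ln 2 :> R by rewrite ln_gt0// ltr1n.
have N0' : 0 < N%:R :> R by rewrite ltr0n.
have p0' : 0 < p%:R :> R by rewrite ltr0n.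
have s0 : 0 < p%:R * (ln 2 / N%:R) :> R by rewrite mulr_gt0// divr_gt0.
have r01 : 0 <= r < 1 by rewrite (ltW (expN_gt0 _)) expN_lt1.
have rle : (1 - r)^-1 <= 1 + N%:R / (p%:R * ln 2).
  apply: le_trans (inv_subexpN_le s0) _; rewrite lerD2l.
  by rewrite invfM invf_div mulrA [_^-1 * _]mulrC -mulrA -invfM.
rewrite -(big_mkord xpredT (fun n => w n * smooth_cutoff p N n)).
rewrite (@big_cat_nat _ _ _ N)//= opprD addrA big_mkord -sumrB.
apply: le_trans (ler_normB _ _) _.
have -> : 2 * C * (1 + N%:R / (p%:R * ln 2)) = C * (1 + N%:R / (p%:R * ln 2)) + C * (1 + N%:R / (p%:R * ln 2)) by ring.
apply: lerD; (apply: (@le_trans _ _ (C * (1 - r)^-1)); last by rewrite ler_wpM2l).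
  apply: (@le_trans _ _ (C * \sum_(i < N) r ^+ i)); last by rewrite ler_wpM2l// sum_expr_le.
  rewrite (reindex_inj rev_ord_inj)/= mulr_sumr.
  apply: le_trans (ler_norm_sum _ _ _) _; apply: ler_sum => n _.
  rewrite -[X in X - _]mulr1 -mulrBr normrM; apply: ler_pM => //.
  have [/(_ (ltn_ord (rev_ord n))) + _] := @smooth_cutoff_err p N (rev_ord n) N0.
  by rewrite /= -subSn ?ltn_ord// subSS subKn// ltnW// ltn_ord.
apply: (@le_trans _ _ (C * \sum_(i < m - N) r ^+ i)); last by rewrite ler_wpM2l// sum_expr_le.
rewrite -{1}[N]add0n big_addn big_mkord mulr_sumr.
apply: le_trans (ler_norm_sum _ _ _) _; apply: ler_sum => n _.
rewrite normrM; apply: ler_pM => //.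
have [_ /(_ (leq_addl _ _))] := @smooth_cutoff_err p N (n + N) N0.
by rewrite addnK.
Qed.

Lemma cvg_shrink (V : R -> R) (c : R) : 0 < c -> V t @[t --> 0^'+] --> 0 ->
  V (c / N%:R) @[N --> \oo] --> 0.
Proof.
move=> c0 V0; apply/cvgr0Pnorm_le => e e0.
have /cvgr0Pnorm_le/(_ _ e0)/near_right0P[d d0 dV] := V0.
near=> N; apply: dV.
have N0 : (0 < N)%N by near: N; exact: nbhs_infty_gt.
rewrite divr_gt0 ?ltr0n//= ltr_pdivrMr ?ltr0n// mulrC -ltr_pdivrMr//.
near: N; exact: nbhs_infty_gtr.
Unshelve. all: by end_near. Qed.

(** Replacing the indicator of $n \le N$ by the cutoff costs $O(1/p)$ on average,
    uniformly in $N$. For fixed $p$ the average against the cutoff is the finite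
    combination [Z N] of values of $V$ at points tending to 0. *)
Lemma bounded_tauber w C : 0 < C -> (forall n, `|w n| <= C) ->
  t * dilate_series expN w t @[t --> 0^'+] --> 0 ->
  (\sum_(n < N) w n) / N%:R @[N --> \oo] --> 0.
Proof.
move=> C0 wC V0.
have ln20 : 0 < ln 2 :> R by rewrite ln_gt0// ltr1n.
apply/cvgr0Pnorm_le => e e0.
have [p pe] := @exists_inv_small R (2 * C / ln 2) (e / 2) (divr_gt0 e0 (ltr0Sn _ _)).
have [c cE] := smooth_cutoff_polyE (2 ^ p.+1).
pose q := (2 ^ p.+1)%N.
pose V t := t * dilate_series expN w t.
(* The monomial $(y^{p+1})^{i+1}$ at $y = e^{-(n+1)t}$ is the exponential kernel
   at $(n+1) k_i t$. *)
pose k (i : nat) : R := i.+1%:R * p.+1%:R.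
have k0 i : 0 < k i by rewrite mulr_gt0.
pose Z (N : nat) : R := \sum_(i < q) c i / (ln 2 * k i) * V (k i * ln 2 / N%:R).
have main N : (0 < N)%N ->
    `|(\sum_(n < N) w n) / N%:R - Z N| <= 2 * C / N%:R + 2 * C / ln 2 / p.+1%:R.
  move=> N0; have N0' : 0 < N%:R :> R by rewrite ltr0n.
  set t : R := ln 2 / N%:R.
  have t0 : 0 < t by rewrite divr_gt0.
  have sE m : \sum_(n < m) w n * smooth_cutoff p.+1 N n =
      \sum_(i < q) c i * dilate_sum expN w (k i * t) m.
    under [RHS]eq_bigr do rewrite /dilate_sum mulr_sumr.
    rewrite exchange_big/=; apply: eq_bigr => n _.
    rewrite /smooth_cutoff cE mulr_sumr; apply: eq_bigr => i _.
    rewrite mulrCA; congr (_ * (_ * _)).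
    by rewrite -exprM -expNM /k /t; congr expN; rewrite natrM; ring.
  have ZE : Z N = (\sum_(i < q) c i * dilate_series expN w (k i * t)) / N%:R.
    rewrite mulr_suml; apply: eq_bigr => i _.
    rewrite -[k i * ln 2 / _]mulrA -/t /V; set D := dilate_series _ _ _.
    rewrite /t; field.
    by rewrite !gt_eqF.
  rewrite ZE -mulrBl normrM [X in _ * X]ger0_norm ?invr_ge0 ?(ltW N0')//.
  rewrite ler_pdivrMr//.
  have -> : (2 * C / N%:R + 2 * C / ln 2 / p.+1%:R) * N%:R
      = 2 * C * (1 + N%:R / (p.+1%:R * ln 2)).
    by field; rewrite !gt_eqF//= addrC natr1.
  have cv : `|\sum_(n < N) w n - \sum_(i < q) c i * dilate_sum expN w (k i * t) m|
     @[m --> \oo] --> `|\sum_(n < N) w n - \sum_(i < q) c i * dilate_series expN w (k i * t)|.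
    apply: cvg_norm; apply: cvgB; first exact: cvg_cst.
    apply: (cvg_sumr (f := fun i m => c i * dilate_sum expN w (k i * t) m)
      (l := fun i => c i * dilate_series expN w (k i * t))) => i.
    apply: cvgMl_tmp; apply: is_cvg_dilate_expN wC.
    by rewrite mulr_gt0.
  apply: cvgr_to_le cv _; near=> m.
  rewrite -sE; apply: smooth_cutoff_sum_err => //; rewrite N0/=; near: m.
  exact: nbhs_infty_ge.
have Z0 : `|Z N| + 2 * C / N%:R @[N --> \oo] --> (0 : R).
  rewrite -[X in _ --> X](addr0 0); apply: cvgD.
    apply/norm_cvg0P.
    have -> : 0 = \sum_(i < q) c i / (ln 2 * k i) * 0 :> R.
      by rewrite big1// => i _; rewrite mulr0.
    apply: (cvg_sumr (f := fun i N => c i / (ln 2 * k i) * V (k i * ln 2 / N%:R))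
      (l := fun i => c i / (ln 2 * k i) * 0)) => i.
    by apply: cvgMl_tmp; apply: cvg_shrink => //; rewrite mulr_gt0.
  have -> : 0 = 2 * C * 0 :> R by rewrite mulr0.
  apply: cvgMl_tmp; rewrite -(cvg_shiftS (fun N : nat => (N%:R : R)^-1 : R^o)).
  exact: cvg_harmonic.
near=> N.
have N0 : (0 < N)%N by near: N; exact: nbhs_infty_gt.
have ZN : `|Z N| + 2 * C / N%:R <= e / 2.
  by near: N; apply: cvgr_le Z0 _ _; rewrite divr_gt0.
have := main N N0; set x := (_ / N%:R); set y := 2 * C / N%:R in ZN *.
move=> xZ; have : `|x| <= `|x - Z N| + `|Z N| by rewrite -{1}(subrK (Z N) x) ler_normD.
by move: pe xZ; set a := 2 * C / ln 2 / _ => pe xZ xle; apply: (le_trans xle); lra.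
Unshelve. all: by end_near. Qed.

End tauber.

(** * The sum of the inverse squares *)

Section basel.
Context {R : realType}.
Implicit Types (x : R) (M n K : nat).

Lemma sin_le_id x : 0 < x -> sin x <= x.
Proof.
move=> x0.
have [|c _] := @MVT R sin cos 0 x x0 (fun y _ => is_derive_sin y).
  by apply: continuous_subspaceT => y; exact: continuous_sin.
by rewrite sin0 !subr0 => ->; rewrite ger_pMl// cos_le1.
Qed.

Lemma id_le_tan x : 0 < x < pi / 2 -> x <= tan x.
Proof.
move=> /andP[x0 xpi].
have cos_pos y : 0 <= y -> y <= x -> 0 < cos y.
  move=> y0 yx; apply: cos_gt0_pihalf; rewrite (le_lt_trans yx xpi) andbT.
  by apply: lt_le_trans y0; rewrite oppr_lt0 divr_gt0// pi_gt0.
have [||c] := @MVT R tan (fun y => (cos y) ^- 2) 0 x x0.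
- move=> y; rewrite in_itv/= => /andP[y0 yx]; apply: is_derive_tan.
  by rewrite gt_eqF// cos_pos// ltW.
- apply: derivable_within_continuous => y; rewrite in_itv/= => /andP[y0 yx].
  by apply: derivable_tan; rewrite gt_eqF// cos_pos.
rewrite in_itv/= => /andP[c0 cx]; rewrite tan0 !subr0 => ->.
have cc := cos_pos c (ltW c0) (ltW cx).
by rewrite ler_peMl ?(ltW x0)// invf_ge1 ?exprn_gt0// exprn_ile1 ?cos_le1 ?(ltW cc).
Qed.

(** $\sin x \le x \le \tan x$, together with $1/\sin^2 x = 1 + 1/\tan^2 x$. *)
Lemma csc2_bounds x : 0 < x < pi / 2 -> x ^- 2 <= sin x ^- 2 <= 1 + x ^- 2.
Proof.
move=> x0pi; have /andP[x0 xpi] := x0pi.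
have s0 : 0 < sin x by exact: sin_gt0_pihalf.
have c0 : 0 < cos x.
  apply: cos_gt0_pihalf; rewrite xpi andbT; apply: lt_trans x0.
  by rewrite oppr_lt0 divr_gt0// pi_gt0.
apply/andP; split.
  rewrite lef_pV2 ?posrE ?exprn_gt0//.
  by apply: lerXn2r; rewrite ?nnegrE ?(ltW s0) ?(ltW x0)// sin_le_id.
have -> : sin x ^- 2 = 1 + tan x ^- 2.
  have := cos2Dsin2 x; rewrite /tan => E.
  have -> : (sin x / cos x) ^- 2 = cos x ^+ 2 / sin x ^+ 2.
    by field; rewrite !gt_eqF.
  by rewrite -{1}[1](divff (_ : sin x ^+ 2 != 0)) ?gt_eqF ?exprn_gt0// -mulrDl addrC E div1r.
have xt := id_le_tan x0pi; have t0 := lt_le_trans x0 xt.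
rewrite lerD2l lef_pV2 ?posrE ?exprn_gt0//.
by apply: lerXn2r; rewrite ?nnegrE ?(ltW t0) ?(ltW x0).
Qed.

(** For $M$ a power of 2 this sum is computed exactly by angle doubling, and its
    terms are compared with $4 M^2/(\pi k)^2$. *)
Definition csc2_sum M : R := \sum_(1 <= k < M) sin (k%:R * pi / (2 * M%:R)) ^- 2.

Lemma angle_itv k M : (1 <= k < M)%N -> 0 < k%:R * (pi : R) / (2 * M%:R) < pi / 2.
Proof.
move=> /andP[k1 kM].
have M0 : 0 < M%:R :> R by rewrite ltr0n (leq_trans _ kM).
have k0 : 0 < k%:R :> R by rewrite ltr0n.
have p0 : 0 < pi :> R := pi_gt0 R.
have -> : k%:R * (pi : R) / (2 * M%:R) = (k%:R / M%:R) * (pi / 2) by field; rewrite gt_eqF.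
by rewrite mulr_gt0 ?divr_gt0//= gtr_pMl ?divr_gt0// ltr_pdivrMr// mul1r ltr_nat.
Qed.

(** $1/\sin^2 x + 1/\cos^2 x = 1/(\sin x \cos x)^2 = 4/\sin^2 (2x)$. *)
Lemma csc2_double x : sin x != 0 -> cos x != 0 ->
  sin x ^- 2 + sin (pi / 2 - x) ^- 2 = 4 * sin (x *+ 2) ^- 2.
Proof.
move=> s0 c0; rewrite -[sin (pi / 2 - x)]opprK -sinN opprB sinBpihalf opprK.
rewrite sin_mulr2n -mulr_natl.
have -> : sin x ^- 2 + cos x ^- 2 = (cos x ^+ 2 + sin x ^+ 2) / (cos x ^+ 2 * sin x ^+ 2).
  by field; rewrite s0 c0.
by rewrite cos2Dsin2; field; rewrite s0 c0.
Qed.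

(** Adding the sum to its own reversal pairs each angle with its complement, so
    [csc2_double] turns twice the sum into a sum over the angles $k\pi/(2M)$ with
    $0 < k < 2M$. That sum is symmetric about its middle term, which is 1. *)
Lemma csc2_sum_double M : (0 < M)%N -> csc2_sum (2 * M) = 4 * csc2_sum M + 2.
Proof.
move=> M0; have M0' : M%:R != 0 :> R by rewrite pnatr_eq0 -lt0n.
pose f k : R := sin (k%:R * pi / (2 * (2 * M)%:R)) ^- 2.
pose h k : R := sin (k%:R * pi / (2 * M%:R)) ^- 2.
suff : csc2_sum (2 * M) *+ 2 = 4 * (2 * csc2_sum M + 1) by rewrite -mulr_natl; lra.
have -> : csc2_sum (2 * M) *+ 2 = \sum_(1 <= k < 2 * M) (f k + f (2 * M - k)%N).
  rewrite mulr2n big_split/=; congr (_ + _).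
  by rewrite /csc2_sum big_nat_rev/=; apply: eq_bigr => k _; rewrite add1n subSS.
have -> : \sum_(1 <= k < 2 * M) (f k + f (2 * M - k)%N) = 4 * \sum_(1 <= k < 2 * M) h k.
  rewrite mulr_sumr [LHS]big_nat_cond [RHS]big_nat_cond; apply: eq_bigr => k.
  rewrite andbT => /andP[k1 kM].
  set x := k%:R * pi / (2 * (2 * M)%:R) : R.
  have M20 : 0 < (2 * M)%:R :> R by rewrite ltr0n muln_gt0.
  have /andP[x0 xpi] : 0 < x < pi / 2 by apply: angle_itv; rewrite k1.
  have -> : f (2 * M - k)%N = sin (pi / 2 - x) ^- 2.
    rewrite /f natrB ?(ltnW kM)//; congr ((sin _ ^+ 2)^-1).
    by rewrite /x; field.
  have -> : h k = sin (x *+ 2) ^- 2.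
    rewrite /h; congr ((sin _ ^+ 2)^-1).
    by rewrite /x natrM -mulr_natl; field.
  apply: csc2_double; rewrite gt_eqF//.
    by rewrite sin_gt0_pihalf// x0.
  rewrite cos_gt0_pihalf// xpi andbT; apply: lt_trans x0.
  by rewrite oppr_lt0 divr_gt0// pi_gt0.
congr (4 * _).
rewrite (@big_cat_nat _ _ _ M)//=; last by rewrite leq_pmull.
rewrite [X in _ + X]big_ltn ?ltn_Pmull//.
have -> : h M = 1.
  by rewrite /h (_ : _ / _ = pi / 2) ?sin_pihalf ?expr1n ?invr1//; field.
have -> : \sum_(M.+1 <= i < 2 * M) h i = \sum_(1 <= i < M) h (i + M)%N.
  by rewrite -[M.+1]add1n big_addn mul2n -addnn addnK.
rewrite [X in _ + (_ + X)]big_nat_rev/=.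
have -> : \sum_(1 <= i < M) h (1 + M - i.+1 + M)%N = csc2_sum M.
  rewrite /csc2_sum [LHS]big_nat_cond [RHS]big_nat_cond; apply: eq_bigr => k.
  rewrite andbT => /andP[k1 kM]; rewrite add1n subSS /h.
  have -> : (M - k + M)%:R * pi / (2 * M%:R) = pi - k%:R * pi / (2 * M%:R) :> R.
    by rewrite natrD natrB ?(ltnW kM)//; field.
  by rewrite sinB sinpi cospi mul0r sub0r mulN1r opprK.
rewrite -/(csc2_sum M); ring.
Qed.

Lemma csc2_sum_pow2 n : csc2_sum (2 ^ n) = 2 * (4 ^+ n - 1) / 3.
Proof.
elim: n => [|n IH]; first by rewrite /csc2_sum big_geq// expr0 subrr mulr0 mul0r.
by rewrite expnS csc2_sum_double ?expn_gt0// IH exprS; field.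
Qed.

Definition zeta2_sum M : R := \sum_(1 <= k < M) k%:R ^- 2.

Lemma zeta2_bounds M : (0 < M)%N ->
  zeta2_sum M <= csc2_sum M * pi ^+ 2 / (4 * M%:R ^+ 2) <= zeta2_sum M + pi ^+ 2 / (4 * M%:R).
Proof.
move=> M0; have M0' : 0 < M%:R :> R by rewrite ltr0n.
have p0 : 0 < pi :> R := pi_gt0 R.
pose a : R := (2 * M%:R / pi) ^+ 2.
have a0 : 0 < a by rewrite exprn_gt0// divr_gt0// mulr_gt0.
have key k : (1 <= k < M)%N -> a * k%:R ^- 2 <= sin (k%:R * pi / (2 * M%:R)) ^- 2 <= 1 + a * k%:R ^- 2.
  move=> /andP[k1 kM].
  have k0 : 0 < k%:R :> R by rewrite ltr0n.
  have -> : a * k%:R ^- 2 = (k%:R * pi / (2 * M%:R)) ^- 2.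
    by rewrite /a; move: (pi : R) p0 => p p0; field; rewrite !gt_eqF.
  by apply: csc2_bounds; apply: angle_itv; rewrite k1.
have E : csc2_sum M * pi ^+ 2 / (4 * M%:R ^+ 2) = csc2_sum M / a.
  by rewrite /a; move: (pi : R) p0 => p p0; field; rewrite !gt_eqF.
rewrite E; apply/andP; split.
  rewrite ler_pdivlMr// mulrC /zeta2_sum mulr_sumr.
  by apply: ler_sum_nat => k /key/andP[].
rewrite ler_pdivrMr//.
apply: (@le_trans _ _ (\sum_(1 <= k < M) (1 + a * k%:R ^- 2))).
  by apply: ler_sum_nat => k /key/andP[].
rewrite big_split/= -mulr_sumr -/(zeta2_sum M) sumr_const_nat mulrDl addrC [a * _]mulrC lerD2l.
apply: (@le_trans _ _ M%:R); first by rewrite ler_nat leq_subr.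
suff <- : M%:R = pi ^+ 2 / (4 * M%:R) * a by [].
by rewrite /a; move: (pi : R) p0 => p p0; field; rewrite !gt_eqF.
Qed.

(** Along $M = 2^n$ the bounds of [zeta2_bounds] are explicit and squeeze the
    partial sums; monotonicity covers the other indices. *)
Theorem basel : \sum_(k < K) k.+1%:R ^- 2 @[K --> \oo] --> (pi ^+ 2 / 6 : R).
Proof.
have SE K : \sum_(k < K) k.+1%:R ^- 2 = zeta2_sum K.+1.
  by rewrite /zeta2_sum big_add1 big_mkord.
have p0 : 0 < pi :> R := pi_gt0 R.
have mono M M' : (0 < M <= M')%N -> zeta2_sum M <= zeta2_sum M'.
  move=> /andP[M0 MM']; rewrite /zeta2_sum (@big_cat_nat _ _ _ M 1 M')//= lerDl.
  by apply: sumr_ge0 => i _; rewrite invr_ge0 exprn_ge0.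
have pow n : csc2_sum (2 ^ n) * pi ^+ 2 / (4 * (2 ^ n)%:R ^+ 2) = pi ^+ 2 / 6 * (1 - (4 ^+ n)^-1).
  rewrite csc2_sum_pow2 natrX -exprM mulnC exprM (_ : 2 ^+ 2 = 4); last by rewrite -natrX.
  by field; rewrite expf_neq0.
have up K : zeta2_sum K.+1 <= pi ^+ 2 / 6.
  apply: (@le_trans _ _ (zeta2_sum (2 ^ K.+1))).
    by apply: mono; rewrite /= ltnW// ltn_expl.
  have /andP[/le_trans + _] := @zeta2_bounds (2 ^ K.+1) (expn_gt0 2 _); apply.
  rewrite pow ler_piMr ?divr_ge0 ?exprn_ge0 ?(ltW p0)// gerBl invr_ge0 exprn_ge0//.
have lo n K : (2 ^ n <= K)%N -> pi ^+ 2 / 6 - pi ^+ 2 / 2 ^+ n <= zeta2_sum K.+1.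
  move=> nK; apply: (@le_trans _ _ (zeta2_sum (2 ^ n))); last first.
    by apply: mono; rewrite expn_gt0/= leqW.
  have /andP[_] := @zeta2_bounds (2 ^ n) (expn_gt0 2 _).
  rewrite pow -lerBlDr; apply: le_trans.
  rewrite natrX (_ : 4 = 2 ^+ 2 :> R); last by rewrite -natrX.
  have b0 : 0 < (2 ^+ n)^-1 :> R by rewrite invr_gt0 exprn_gt0.
  have b1 : (2 ^+ n)^-1 <= 1 :> R by rewrite invf_le1 ?exprn_gt0// exprn_ege1// ler1n.
  have q0 : 0 < pi ^+ 2 :> R by rewrite exprn_gt0.
  rewrite -exprM mulnC exprM [(2 ^+ 2 * _)^-1]invfM.
  rewrite -[((2 ^+ n) ^+ 2)^-1]exprVn.
  set b := (2 ^+ n)^-1 in b0 b1 *.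
  move: (pi ^+ 2 : R) q0 => q q0.
  have : q * b ^+ 2 <= q * b by rewrite ler_pM2l// expr2 ger_pMl.
  have : 0 < q * b by rewrite mulr_gt0.
  by rewrite (_ : 2 ^+ 2 = 4 :> R) ?mulrA; [nra | rewrite -natrX].
apply/cvgrPdist_le => e e0.
have c0 : pi ^+ 2 / 2 ^+ n @[n --> \oo] --> (0 : R).
  rewrite -[X in _ --> X](mulr0 (pi ^+ 2)); apply: cvgMl_tmp.
  under eq_fun do rewrite -exprVn.
  by apply: cvg_expr; rewrite ger0_norm ?invr_ge0// invf_lt1// ltr1n.
have [n ne] : exists n, pi ^+ 2 / 2 ^+ n <= e.
  by have /cvgr_le /(_ e e0) [j _ /(_ j (leqnn j))] := c0; exists j.
near=> K; rewrite SE ger0_norm ?subr_ge0 ?up//.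
have nK : (2 ^ n <= K)%N by near: K; exact: nbhs_infty_ge.
by have := lo n K nK; lra.
Unshelve. all: by end_near. Qed.
End basel.

(** * A recursion for partitions with bounded parts *)

Section partition_recursion.
Implicit Types (A B : set nat) (m n c : nat).

Definition pos_set A := forall a, A a -> (0 < a)%N.
Definition parts_upto A m : set nat := A `&` [set a | (a <= m)%N].

Lemma parts_upto_pos A m : pos_set A -> pos_set (parts_upto A m).
Proof. by move=> A0 a [/A0]. Qed.

Lemma mem_le_sumn (s : seq nat) a : a \in s -> (a <= sumn s)%N.
Proof. by move=> /rot_to[i s' E]; rewrite -(sumn_rot s i) E /= leq_addr. Qed.

Lemma partition_fun_le A B n : pos_set B -> A `<=` B ->
  (partition_fun A n <= partition_fun B n)%N.
Proof.
move=> B0 AB; apply: fsubset_leq_card.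
have A0 : pos_set A by move=> a /AB/B0.
rewrite -fset_set_sub; [|exact: finite_partitions|exact: finite_partitions].
by move=> s [ss sA sn]; split=> // a /sA/AB.
Qed.

Lemma partition_fun_upto A m n : pos_set A -> (n <= m)%N ->
  partition_fun (parts_upto A m) n = partition_fun A n.
Proof.
move=> A0 nm; rewrite /partition_fun; congr (#|` fset_set _ |)%fset.
apply/seteqP; split=> s [ss sA sn]; split=> // a sa.
  by case: (sA a sa).
split; first exact: sA.
by rewrite /= (leq_trans _ nm)// -sn mem_le_sumn.
Qed.

Lemma partition_fun_rec_notin A m n : ~ A m.+1 ->
  partition_fun (parts_upto A m.+1) n = partition_fun (parts_upto A m) n.
Proof.
move=> Am; congr partition_fun; apply/seteqP; split=> a [Aa /= am]; split=> //=.
  by move: am; rewrite leq_eqVlt => /predU1P[aE|//]; rewrite aE in Aa.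
exact: leqW.
Qed.

(** A nonincreasing list with entries at most $m+1$ either starts with $m+1$,
    which can be removed, or has all its entries at most $m$. *)
Lemma partitions_rec A m n : A m.+1 -> (m.+1 <= n)%N ->
  partitions (parts_upto A m.+1) n =
  partitions (parts_upto A m) n `|`
  (cons m.+1 @` partitions (parts_upto A m.+1) (n - m.+1)).
Proof.
move=> Am mn; apply/seteqP; split=> s.
- move=> [ss sA sn]; case: s ss sA sn => [|a s] /= ss sA sn.
    by rewrite -sn in mn.
  have [Aa /= ] := sA a (mem_head _ _).
  rewrite leq_eqVlt => /predU1P[aE|am].
    right; exists s; last by rewrite aE.
    split; first exact: path_sorted ss.
      by move=> b bs; apply: sA; rewrite inE bs orbT.
    by rewrite -sn aE addKn.
  left; split=> // b bas; have [Ab _] := sA b bas; split=> //=.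
  move: bas; rewrite inE => /predU1P[->//|bs].
  have tr : transitive geq by move=> x y z /= yx zy; apply: leq_trans zy yx.
  have /allP/(_ b bs)/= ba := order_path_min tr ss.
  exact: leq_trans ba am.
- case=> [[ss sA sn]|[s' [ss sA sn] <-]].
    by split=> // a /sA[Aa /= am]; split=> //=; apply: leqW.
  split=> /=.
  + by rewrite path_min_sorted//; apply/allP => a /sA[].
  + by move=> a; rewrite inE => /predU1P[->|/sA//]; split=> /=.
  + by rewrite sn subnKC.
Qed.

(** The two kinds of partitions in [partitions_rec] are disjoint, because only
    those of the second kind contain $m+1$. *)
Lemma partition_fun_rec A m n : pos_set A -> A m.+1 ->
  partition_fun (parts_upto A m.+1) n = (partition_fun (parts_upto A m) n +
    if (m.+1 <= n)%N then partition_fun (parts_upto A m.+1) (n - m.+1) else 0)%N.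
Proof.
move=> A0 Am; case: ifPn => mn; last first.
  by rewrite addn0 -ltnNge in mn *; rewrite !partition_fun_upto// ltnW.
rewrite {1}/partition_fun partitions_rec// fset_setU; last 2 first.
- exact/finite_partitions/parts_upto_pos.
- exact/finite_image/finite_partitions/parts_upto_pos.
rewrite fset_set_image; last exact/finite_partitions/parts_upto_pos.
rewrite cardfsU (_ : (_ `&` _)%fset = fset0) ?cardfs0 ?subn0.
  by rewrite card_imfset//= => s s' [].
apply/eqP; rewrite -fsubset0; apply/fsubsetP => s; rewrite !inE => /andP[+ /imfsetP[s' /= _ sE]].
rewrite in_fset_set; last exact/finite_partitions/parts_upto_pos.
move=> /set_mem[_ /(_ m.+1) + _]; rewrite sE mem_head => /(_ isT)[_ /=].
by rewrite ltnn.
Qed.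

Lemma partition_fun_upto0 A n : pos_set A ->
  partition_fun (parts_upto A 0) n = (n == 0)%N.
Proof.
move=> A0; have B0 : pos_set (parts_upto A 0) by exact: parts_upto_pos.
case: n => [|n]; first exact: partition_fun0.
rewrite /partition_fun (_ : partitions _ _ = set0) ?fset_set0 ?cardfs0//.
apply/seteqP; split=> // -[|a s] [_ sA //= _].
by have [/A0 + /=] := sA a (mem_head _ _); case: a {sA}.
Qed.

End partition_recursion.

(** * Euler's product for the partition function *)

Section generating_function.
Context {R : realType}.
Implicit Types (A : set nat) (x t P B : R) (m n : nat).

(** With $G_N$ and $F_N$ the partial sums for [v] and [u], the recursion reads
    $G_{N+c} = F_{N+c} + x^c G_N$. As $G$ is nondecreasing this bounds $G$, so $G$
    converges, and the limit solves the same linear equation. *)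
Lemma gf_recursion (u v : nat -> R) (c : nat) (x P : R) : (0 < c)%N -> 0 < x < 1 ->
  (forall n, 0 <= v n) ->
  (forall n, v n = u n + if (c <= n)%N then v (n - c)%N else 0) ->
  \sum_(n < N) u n * x ^+ n @[N --> \oo] --> P ->
  \sum_(n < N) v n * x ^+ n @[N --> \oo] --> P / (1 - x ^+ c).
Proof.
move=> c0 /andP[x0 x1] v0 vE uP.
pose F N := \sum_(n < N) u n * x ^+ n.
pose G N := \sum_(n < N) v n * x ^+ n.
have y0 : 0 < x ^+ c by rewrite exprn_gt0.
have y1 : 0 < 1 - x ^+ c by rewrite subr_gt0 exprn_ilt1 ?(ltW x0)// -lt0n.
have GE N : G (N + c)%N = F (N + c)%N + x ^+ c * G N.
  rewrite /G /F; under eq_bigr do rewrite vE mulrDl.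
  rewrite big_split/=; congr (_ + _).
  rewrite -(big_mkord xpredT (fun n => (if (c <= n)%N then v (n - c)%N else 0) * x ^+ n)).
  rewrite (@big_cat_nat _ _ _ c)//= ?leq_addl// big_nat_cond big1 ?add0r; last first.
    by move=> i; rewrite andbT => /andP[_ ic]; rewrite leqNgt ic mul0r.
  rewrite -{1}[c]add0n big_addn addnK big_mkord mulr_sumr; apply: eq_bigr => n _.
  by rewrite leq_addl addnK exprD mulrA mulrC.
have Gmono : nondecreasing_seq G.
  apply/nondecreasing_seqP => N; rewrite /G big_ord_recr/= lerDl.
  by rewrite mulr_ge0// exprn_ge0// ltW.
have [M FM] : exists M, forall N, F N <= M.
  have /cvgP/cvg_has_ub [M MF] := uP; exists M => N.
  by apply: le_trans (ler_norm _) _; apply: MF; exists N.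
have cG : cvgn G.
  apply: nondecreasing_is_cvgn => //; exists (M / (1 - x ^+ c)) => _ [N _ <-].
  rewrite ler_pdivlMr// mulrBr mulr1 lerBlDr mulrC.
  apply: le_trans (lerD (FM (N + c)%N) (lexx _)); rewrite -GE.
  by apply: Gmono; rewrite leq_addr.
have E : limn G = P + x ^+ c * limn G.
  have c1 : G (N + c)%N @[N --> \oo] --> limn G.
    by have := cG; rewrite -(cvg_shiftn c G); exact.
  have c2 : G (N + c)%N @[N --> \oo] --> P + x ^+ c * limn G.
    have -> : (fun N => G (N + c)%N) = (fun N => F (N + c)%N + x ^+ c * G N).
      exact/funext.
    apply: cvgD; last exact: cvgMl_tmp.
    by have := uP; rewrite -(cvg_shiftn c F); exact.
  exact: (cvg_unique _ c1 c2).
suff <- : limn G = P / (1 - x ^+ c) by [].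
have y1' : 1 - x ^+ c != 0 by rewrite gt_eqF.
by apply: (mulIf y1'); rewrite divfK// mulrBr mulr1 {1}E mulrC addrK.
Qed.

(** Induction on the largest allowed part: admitting the part $m+1$ multiplies
    the generating function by $(1 - x^{m+1})^{-1}$, by [gf_recursion]. *)
Lemma euler_product A m x : pos_set A -> 0 < x < 1 ->
  \sum_(n < N) (partition_fun (parts_upto A m) n)%:R * x ^+ n @[N --> \oo] -->
  \prod_(a < m | a.+1 \in A) (1 - x ^+ a.+1)^-1.
Proof.
move=> A0 x01; elim: m => [|m IH].
  rewrite big_ord0 -(cvg_shiftS (fun N => \sum_(n < N) (partition_fun (parts_upto A 0) n)%:R * x ^+ n)).
  have -> : (fun N => \sum_(n < N.+1) (partition_fun (parts_upto A 0) n)%:R * x ^+ n) = cst 1.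
    apply/funext => N; rewrite big_ord_recl/= big1 => [|n _].
      by rewrite partition_fun_upto0// expr0 mulr1 addr0.
    by rewrite partition_fun_upto0// mul0r.
  exact: cvg_cst.
rewrite big_mkcond big_ord_recr/= -big_mkcond/=; case: ifPn => [|].
  move=> /set_mem Am; apply: (gf_recursion (u := fun n => (partition_fun (parts_upto A m) n)%:R)
    (v := fun n => (partition_fun (parts_upto A m.+1) n)%:R)) => //.
  by move=> n; rewrite partition_fun_rec// natrD; case: ifP.
move=> Am'; have Am : ~ A m.+1 by move=> /mem_set; apply/negP.
rewrite mulr1.
by under eq_fun do under eq_bigr do rewrite partition_fun_rec_notin//.
Qed.

Lemma ln_euler_product A m t : 0 < t ->
  ln (\prod_(a < m | a.+1 \in A) (1 - expN t ^+ a.+1)^-1) =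
  dilate_sum log_factor (fun n => \1_A n.+1) t m.
Proof.
move=> t0; rewrite /dilate_sum.
have pos a : 0 < (1 - expN t ^+ a.+1)^-1.
  by rewrite invr_gt0 subr_gt0 -expNM expN_lt1// mulr_gt0.
elim: m => [|m IH]; first by rewrite !big_ord0 ln1.
rewrite big_mkcond !big_ord_recr/= -big_mkcond/= lnM ?posrE; last 2 first.
- by apply: prodr_gt0.
- by case: ifP.
rewrite IH indicE; congr (_ + _); case: ifPn => _; last by rewrite ln1 mul0r.
by rewrite mul1r /log_factor expNM lnV// posrE -invr_gt0.
Qed.

(** The single term $p_A(n) e^{-nt}$ is at most the product over the parts up to
    $m$, as soon as $m \ge n$. *)
Lemma ln_partition_le A n t : pos_set A -> 0 < t -> (0 < partition_fun A n)%N ->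
  ln (partition_fun A n)%:R - n%:R * t <= dilate_series log_factor (fun n => \1_A n.+1) t.
Proof.
move=> A0 t0 pn.
have x01 : 0 < expN t < 1 by rewrite expN_gt0 expN_lt1.
apply: limr_ge.
  apply: (@is_cvg_dilate_log_factor _ _ _ 1) => // k.
  by rewrite indicE ger0_norm ?lern1 ?ler_n0n ?leq_b1.
near=> m; rewrite -ln_euler_product//.
have nm : (n <= m)%N by near: m; exact: nbhs_infty_ge.
have -> : ln (partition_fun A n)%:R - n%:R * t = ln ((partition_fun A n)%:R * expN (n%:R * t)).
  by rewrite lnM ?posrE ?expN_gt0 ?ltr0n// /expN expRK.
rewrite ler_ln ?posrE ?mulr_gt0 ?expN_gt0 ?ltr0n//; last first.
  by apply: prodr_gt0 => a _; rewrite invr_gt0 subr_gt0 -expNM expN_lt1// mulr_gt0.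
apply: cvgr_to_ge (@euler_product A m _ A0 x01) _; near=> N.
have nN : (n < N)%N by near: N; exact: nbhs_infty_gt.
rewrite (bigD1 (Ordinal nN))//= partition_fun_upto// expNM lerDl.
by apply: sumr_ge0 => i _; rewrite mulr_ge0// exprn_ge0// ltW// expN_gt0.
Unshelve. all: by end_near. Qed.

(** Each finite product counts only some of the partitions, hence is at most any
    bound for the partial sums of the full generating function. *)
Lemma dilate_log_factor_le_ln A t B : pos_set A -> 0 < t ->
  (forall N, \sum_(n < N) (partition_fun A n)%:R * expN t ^+ n <= B) ->
  dilate_series log_factor (fun n => \1_A n.+1) t <= ln B.
Proof.
move=> A0 t0 pB.
have x01 : 0 < expN t < 1 by rewrite expN_gt0 expN_lt1.
apply: limr_le.
  apply: (@is_cvg_dilate_log_factor _ _ _ 1) => // k.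
  by rewrite indicE ger0_norm ?lern1 ?ler_n0n ?leq_b1.
apply: nearW => m; rewrite -ln_euler_product//.
have P0 : 0 < \prod_(a < m | a.+1 \in A) (1 - expN t ^+ a.+1)^-1.
  by apply: prodr_gt0 => a _; rewrite invr_gt0 subr_gt0 -expNM expN_lt1// mulr_gt0.
have PB : \prod_(a < m | a.+1 \in A) (1 - expN t ^+ a.+1)^-1 <= B.
  apply: cvgr_to_le (@euler_product A m _ A0 x01) _; apply: nearW => N.
  apply: le_trans (pB N); apply: ler_sum => n _.
  rewrite ler_wpM2r ?exprn_ge0 ?(ltW (expN_gt0 _))// ler_nat.
  by apply: partition_fun_le => // a [].
by rewrite ler_ln ?posrE ?(lt_le_trans P0).
Qed.

End generating_function.

(** * From the growth of partitions to the generating function *)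

Section abelian.
Context {R : realType}.
Implicit Types (A : set nat) (t b d : R) (n : nat).

(** The exponent $2 b \sqrt n - n t$ is largest at $\sqrt n = b/t$. Taking for $n$
    the square of the integer part [v] of $b/t$ removes the square root. *)
Lemma log_partition_lower A b d : pos_set A -> 0 < d < b ->
  (\forall n \near \oo, 2 * (b - d) * Num.sqrt n%:R <= ln ((partition_fun A n)%:R : R)) ->
  \forall t \near (0 : R)^'+,
    b ^+ 2 - 2 * b * d - 2 * b * t <= t * dilate_series log_factor (fun n => \1_A n.+1) t.
Proof.
move=> A0 /andP[d0 db] [n0 _ n0P]; have b0 : 0 < b by exact: lt_trans db.
apply/near_right0P; exists (b / n0.+1%:R); first by rewrite divr_gt0.
move=> t /andP[t0 tb].
pose v := Num.truncn (b / t).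
have bt0 : 0 <= b / t by rewrite divr_ge0// ltW.
have /andP[v1 v2] := truncn_itv bt0; rewrite -/v in v1 v2.
have vn0 : (n0.+1 <= v)%N.
  rewrite truncn_ge_nat// ler_pdivlMr// mulrC -ler_pdivlMr//; exact: ltW.
have v0 : 0 < v%:R :> R by rewrite ltr0n (leq_trans _ vn0).
have := n0P (v ^ 2)%N => /=.
have vle : (n0 <= v ^ 2)%N.
  by rewrite (leq_trans (ltnW vn0))// expnS expn1 leq_pmulr// (leq_trans _ vn0).
move=> /(_ vle); rewrite natrX sqrtr_sqr gtr0_norm// => lnp.
have p0 : (0 < partition_fun A (v ^ 2))%N.
  rewrite lt0n; apply/eqP => E; move: lnp; rewrite E ln0//.
  by rewrite leNgt mulr_gt0// mulr_gt0// subr_gt0.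
have := ln_partition_le A0 t0 p0.
move=> /(le_trans (lerB lnp (lexx _))); rewrite natrX.
rewrite -(ler_pM2l t0) => /(le_trans _); apply.
have {}v1 : t * v%:R <= b by rewrite mulrC -ler_pdivlMr.
have {}v2 : b - t <= t * v%:R.
  by move: v2; rewrite ltr_pdivrMr// -natr1 => /ltW; lra.
have -> : t * (2 * (b - d) * v%:R - v%:R ^+ 2 * t) = 2 * (b - d) * (t * v%:R) - (t * v%:R) ^+ 2.
  by ring.
have s0 : 0 < t * v%:R by rewrite mulr_gt0.
set s := t * v%:R in v1 v2 s0 *.
nra.
Qed.

(** With $b' = b + d$ and $1 - \eta = b'/(b'+d)$, the inequality between
    arithmetic and geometric means gives
    $2 b' \sqrt n \le (1 - \eta) n t + b'(b'+d)/t$. So $p_A(n) e^{-nt}$ is dominated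
    by a geometric sequence of ratio $e^{-\eta t}$; the logarithm of its sum is
    $b'(b'+d)/t$ up to a term that is $o(1/t)$. *)
Lemma log_partition_upper A b d : pos_set A -> 0 < b -> 0 < d ->
  (\forall n \near \oo, ln ((partition_fun A n)%:R : R) <= 2 * (b + d) * Num.sqrt n%:R) ->
  \forall t \near (0 : R)^'+,
    t * dilate_series log_factor (fun n => \1_A n.+1) t <= (b + d) * (b + 2 * d) + 2 * d.
Proof.
move=> A0 b0 d0 [n0 _ n0P].
(* The constant D absorbs the finitely many n for which the upper bound on
   $\log p_A(n)$ may fail. *)
pose D : R := 1 + \sum_(n < n0) (partition_fun A n)%:R.
have D1 : 1 <= D by rewrite lerDl sumr_ge0.
have D0 : 0 < D by exact: lt_le_trans D1.
pose b' := b + d; have b'0 : 0 < b' by rewrite addr_gt0.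
have pD n : (partition_fun A n)%:R <= D * expR (2 * b' * Num.sqrt n%:R).
  have e1 : 1 <= expR (2 * b' * Num.sqrt n%:R).
    by rewrite -expR0 ler_expR !mulr_ge0 ?sqrtr_ge0 ?(ltW b'0).
  have [nn0|nn0] := ltnP n n0.
    apply: (@le_trans _ _ D); last by rewrite ler_peMr ?(ltW D0).
    rewrite /D (bigD1 (Ordinal nn0))//= addrCA lerDl addr_ge0//.
    by apply: sumr_ge0.
  have := n0P n nn0 => /= lnp.
  have [->|p0] := posnP (partition_fun A n); first by rewrite mulr_ge0 ?expR_ge0 ?(ltW D0).
  apply: (@le_trans _ _ (expR (2 * b' * Num.sqrt n%:R))); last by rewrite ler_peMl ?expR_ge0.
  by rewrite -[leLHS]lnK ?posrE ?ltr0n// ler_expR.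
have bd0 : 0 < b' + d by rewrite addr_gt0.
have [eta eta0 etaE] : exists2 eta : R, 0 < eta & eta = 1 - b' / (b' + d).
  by exists (d / (b' + d)); [rewrite divr_gt0 | field; rewrite gt_eqF].
(* K collects the terms that do not depend on t; it is multiplied by t in the
   end, and the bound on t makes this contribution at most d. *)
pose K := ln D + eta * d - ln (eta * d).
pose K1 := 1 + `|K|.
have K10 : 0 < K1 by rewrite ltr_wpDr.
apply/near_right0P; exists (d / K1); first by rewrite divr_gt0.
move=> t /andP[t0 td].
have et0 : 0 < eta * t by rewrite mulr_gt0.
pose B := D * expR (b' * (b' + d) / t) * (1 + (eta * t)^-1).
have B1 : 0 < 1 + (eta * t)^-1 by rewrite addr_gt0// invr_gt0.
have key N : \sum_(n < N) (partition_fun A n)%:R * expN t ^+ n <= B.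
  have e01 : 0 <= expN (eta * t) < 1 by rewrite (ltW (expN_gt0 _)) expN_lt1.
  apply: (@le_trans _ _ (\sum_(n < N) D * expR (b' * (b' + d) / t) * expN (eta * t) ^+ n)); last first.
    rewrite -mulr_sumr /B ler_wpM2l ?mulr_ge0 ?expR_ge0 ?(ltW D0)//.
    exact: le_trans (sum_expr_le _ e01) (inv_subexpN_le et0).
  apply: ler_sum => n _.
  apply: (@le_trans _ _ (D * expR (2 * b' * Num.sqrt n%:R) * expN t ^+ n)).
    by rewrite ler_wpM2r// exprn_ge0// ltW// expN_gt0.
  rewrite -!mulrA ler_pM2l// -!expNM /expN -!expRD ler_expR.
  have : (Num.sqrt n%:R) ^+ 2 = n%:R :> R by rewrite sqr_sqrtr.
  set s := Num.sqrt n%:R => <-.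
  have : 0 <= (b' * t * s - b' * (b' + d)) ^+ 2 / (b' * (b' + d) * t).
    by rewrite divr_ge0 ?sqr_ge0// !mulr_ge0// ltW.
  have -> : (b' * t * s - b' * (b' + d)) ^+ 2 / (b' * (b' + d) * t) =
     (1 - eta) * t * s ^+ 2 - 2 * b' * s + b' * ((b' + d) / t).
    by rewrite etaE; field; rewrite !gt_eqF.
  set c := (b' + d) / t; lra.
have B0 : 0 < B by rewrite !mulr_gt0// expR_gt0.
have := dilate_log_factor_le_ln A0 t0 key.
rewrite -(ler_pM2l t0) => /le_trans; apply.
rewrite /B lnM ?posrE ?mulr_gt0 ?expR_gt0// lnM ?posrE ?expR_gt0// expRK.
have ed0 : 0 < eta * d by rewrite mulr_gt0.
(* $\log z \le \epsilon z - \log \epsilon$ with $\epsilon = \eta d$: the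
   divergent part of $\epsilon z$ is $d/t$, small after multiplication by t. *)
have lnle : ln (1 + (eta * t)^-1) <= eta * d * (1 + (eta * t)^-1) - ln (eta * d).
  rewrite lerBrDl -lnM ?posrE//.
  by apply/ltW/ln_sublinear; rewrite mulr_gt0.
have tK : t * K <= d.
  apply: (@le_trans _ _ (t * K1)); last by rewrite -ler_pdivlMr// ltW.
  rewrite ler_pM2l// /K1; apply: (le_trans (ler_norm _)); lra.
apply: (@le_trans _ _ (t * (ln D + b' * (b' + d) / t + (eta * d * (1 + (eta * t)^-1) - ln (eta * d))))).
  by rewrite ler_pM2l// lerD2l.
have -> : t * (ln D + b' * (b' + d) / t + (eta * d * (1 + (eta * t)^-1) - ln (eta * d)))
  = b' * (b' + d) + d + t * K.
  rewrite /K; field; rewrite !gt_eqF//.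
rewrite /b'; lra.
Qed.

(** Both bounds hold for every $d > 0$ and differ from $b^2$ by $O(d)$ as $t$
    tends to 0. *)
Lemma log_partition_abelian A b : pos_set A -> 0 < b ->
  ln ((partition_fun A n)%:R : R) / (2 * b * Num.sqrt n%:R) @[n --> \oo] --> (1 : R) ->
  t * dilate_series log_factor (fun n => \1_A n.+1) t @[t --> (0 : R)^'+] --> b ^+ 2.
Proof.
move=> A0 b0 H.
have bounds d : 0 < d -> \forall n \near \oo,
   2 * (b - d) * Num.sqrt n%:R <= ln ((partition_fun A n)%:R : R) <= 2 * (b + d) * Num.sqrt n%:R.
  move=> d0; have db : 0 < d / b by rewrite divr_gt0.
  have /cvgrPdist_le/(_ _ db) := H; move=> Hn; near=> n.
  have n0 : (0 < n)%N by near: n; exact: nbhs_infty_gt.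
  have : `|1 - ln ((partition_fun A n)%:R : R) / (2 * b * Num.sqrt n%:R)| <= d / b by near: n.
  have s0 : 0 < Num.sqrt n%:R :> R by rewrite sqrtr_gt0 ltr0n.
  set s := Num.sqrt n%:R in s0 *; set l := ln _.
  have -> : 1 - l / (2 * b * s) = (2 * b * s - l) / (2 * b * s).
    by field; rewrite !gt_eqF.
  have bs0 : 0 < 2 * b * s by rewrite !mulr_gt0.
  rewrite normrM [X in _ * X]ger0_norm ?invr_ge0 ?(ltW bs0)// ler_pdivrMr//.
  have -> : d / b * (2 * b * s) = 2 * d * s by field; rewrite gt_eqF.
  rewrite ler_norml => /andP[h1 h2]; apply/andP; split; lra.
apply/cvgrPdist_le => e e0.
pose M := 3 * b + 4.
have M0 : 0 < M by rewrite addr_gt0// mulr_gt0.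
pose d := Num.min (b / 2) (Num.min 1 (e / (2 * M))).
have d0 : 0 < d by rewrite !lt_min divr_gt0//= ltr01 divr_gt0// mulr_gt0.
have db : d <= b / 2 by rewrite ge_min lexx.
have d1 : d <= 1 by rewrite !ge_min lexx orbT.
have de : d <= e / (2 * M) by rewrite !ge_min lexx !orbT.
have dM : d * M <= e / 2.
  rewrite -ler_pdivlMr//; apply: le_trans de _.
  by rewrite invfM mulrA.
have lo : \forall t \near (0 : R)^'+,
    b ^+ 2 - 2 * b * d - 2 * b * t <= t * dilate_series log_factor (fun n => \1_A n.+1) t.
  apply: log_partition_lower => //; first by rewrite d0/=; lra.
  by apply: filterS (bounds d d0) => n /andP[].
have up : \forall t \near (0 : R)^'+,
    t * dilate_series log_factor (fun n => \1_A n.+1) t <= (b + d) * (b + 2 * d) + 2 * d.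
  apply: log_partition_upper => //.
  by apply: filterS (bounds d d0) => n /andP[].
near=> t.
have t0 : 0 < t by near: t; exact: nbhs_right_gt.
have tb : t < e / (4 * b).
  by near: t; apply: nbhs_right_lt; rewrite divr_gt0// mulr_gt0.
have {}tb : 2 * b * t <= e / 2.
  by move: tb; rewrite ltr_pdivlMr ?mulr_gt0//; lra.
have : b ^+ 2 - 2 * b * d - 2 * b * t <= t * dilate_series log_factor (fun n => \1_A n.+1) t by near: t.
have : t * dilate_series log_factor (fun n => \1_A n.+1) t <= (b + d) * (b + 2 * d) + 2 * d by near: t.
set X := t * _ => h1 h2; rewrite ler_norml; rewrite /M in dM.
apply/andP; split; nra.
Unshelve. all: by end_near. Qed.

End abelian.

(** * Averages, counting functions and density *)

Section density.
Context {R : realType}.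
Implicit Types (A : set nat) (t b d : R) (n : nat).

(** The sum is $1/(e^t - 1) = 1/(1-e^{-t}) - 1$, and $1 - e^{-t} \le t$. *)
Lemma scaled_laplace1_bounds t : 0 < t -> 1 - t <= t * dilate_series expN (fun=> 1) t <= 1.
Proof.
move=> t0; have y0 := expN_gt0 t; have y1 := expN_lt1 t0.
have y1' : 0 < 1 - expN t by rewrite subr_gt0.
have dE : dilate_series expN (fun=> 1) t = expN t / (1 - expN t).
  apply: cvg_lim => //.
  have -> : dilate_sum expN (fun=> 1) t = series (geometric (expN t) (expN t)).
    rewrite seriesEord; apply/funext => m; apply: eq_bigr => i _.
    by rewrite mul1r expNM exprS.
  by apply: cvg_geometric_series; rewrite gtr0_norm.
apply/andP; split; last first.
  have := @scaled_laplace_le R (fun=> 1) t 1 t0 (fun=> _).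
  by rewrite normr1 => /(_ (fun=> lexx _))/(le_trans (ler_norm _)).
rewrite dE mulrA ler_pdivlMr//.
have : 1 - t <= expN t by have := expR_ge1Dx (- t); rewrite /expN.
set y := expN t in y0 y1 *; nra.
Qed.

(** For constant weights $V(t) \to 1$, so the expansion $\sum_k V(kt)/k^2$ tends to
    $\zeta(2)$; truncating it at $K+1$ terms makes the error at most $1/(K+1)$,
    uniformly in $t$. *)
Lemma scaled_log_factor1 :
  t * dilate_series log_factor (fun=> 1) t @[t --> (0 : R)^'+] --> pi ^+ 2 / 6.
Proof.
apply/cvgrPdist_le => e e0.
have e4 : 0 < e / 4 by rewrite divr_gt0.
have [K [K1 K2]] : exists K, 1 / K.+1%:R <= e / 4 /\
    `|pi ^+ 2 / 6 - \sum_(k < K.+1) k.+1%:R ^- 2| <= e / 4.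
  have /cvgrPdist_le/(_ _ e4) [k0 _ k0P] := @basel R.
  have [k1 k1P] := exists_inv_small 1 e4.
  exists (maxn k0 k1); split.
    by apply: le_trans k1P; rewrite ler_pM2l// lef_pV2 ?posrE// ler_nat ltnS leq_maxr.
  by apply: k0P => /=; rewrite leqW// leq_maxl.
apply/near_right0P; exists (e / 4 / K.+1%:R); first by rewrite divr_gt0.
move=> t /andP[t0 te].
have tK : K.+1%:R * t <= e / 4 by rewrite mulrC -ler_pdivlMr// ltW.
have := @scaled_log_factor_approx R (fun=> 1) t 1 K t0.
rewrite normr1 => /(_ (fun=> lexx _)).
set S := \sum_(_ < _) _; set X := t * dilate_series _ _ _ => XS.
set Z := \sum_(_ < _) _ in K2.
have SZ : `|S - Z| <= e / 4.
  rewrite /S /Z -sumrB; apply: le_trans (ler_norm_sum _ _ _) _.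
  apply: le_trans tK; rewrite mulr_natl.
  have -> : t *+ K.+1 = \sum_(k < K.+1) t by rewrite sumr_const card_ord.
  apply: ler_sum => k _.
  have kt : 0 < k.+1%:R * t by rewrite mulr_gt0.
  have /andP[] := scaled_laplace1_bounds kt.
  set v := k.+1%:R * t * _ => v1 v2.
  have -> : v / k.+1%:R ^+ 2 - k.+1%:R ^- 2 = - ((1 - v) / k.+1%:R ^+ 2).
    by field; rewrite addrC natr1.
  rewrite normrN ger0_norm; last by rewrite divr_ge0 ?subr_ge0// exprn_ge0.
  rewrite ler_pdivrMr ?exprn_gt0//.
  apply: (@le_trans _ _ (k.+1%:R * t)); first by lra.
  rewrite mulrC ler_pM2l// expr2 ler_peMr// ler1n//.
move: (le_trans XS K1) K2 SZ; rewrite !ler_norml => /andP[? ?] /andP[? ?] /andP[? ?].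
clearbody X S Z; apply/andP; split; lra.
Qed.

Lemma counting_fun_sum A (x : R) : pos_set A ->
  (counting_fun A x)%:R = \sum_(n < Num.truncn x) \1_A n.+1 :> R.
Proof.
move=> A0; rewrite /counting_fun.
have -> : counting_set A x = parts_upto A (Num.truncn x).
  apply/seteqP; split => a [Aa /= ax]; split=> //=.
    by rewrite truncn_ge_nat//; apply: le_trans ax.
  have x0 : 0 <= x.
    rewrite leNgt; apply/negP => xlt; move: ax; rewrite (_ : Num.truncn x = 0%N).
      by rewrite leqn0 => /eqP aE; have := A0 _ Aa; rewrite aE.
    by apply/truncn0Pn; rewrite -ltNge (lt_trans xlt).
  by rewrite -truncn_ge_nat.
elim: (Num.truncn x) => [|N IH].
  rewrite big_ord0 (_ : parts_upto A 0 = set0) ?fset_set0 ?cardfs0//.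
  by apply/seteqP; split=> // a [/A0 + /=]; case: a.
have fin : finite_set (parts_upto A N).
  by apply: (sub_finite_set _ (finite_II N.+1)) => a [_].
rewrite big_ord_recr/= -IH indicE; case: (boolP (N.+1 \in A)) => NA.
  have -> : parts_upto A N.+1 = N.+1 |` parts_upto A N.
    apply/seteqP; split=> a.
      move=> [Aa /=]; rewrite leq_eqVlt => /predU1P[->|aN]; [by left|by right].
    move=> [->|[Aa /= aN]]; first by split=> //=; exact: set_mem.
    by split=> //=; exact: leqW.
  have NN : N.+1 \notin parts_upto A N by apply/negP => /set_mem[_ /=]; rewrite ltnn.
  rewrite fset_setU1// cardfsU1 in_fset_set// NN.
  by rewrite -[X in _ = _ + X]/(1%:R) -natrD addnC.
rewrite addr0; congr (#|` fset_set _ |%fset)%:R.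
apply/seteqP; split=> a [Aa /= aN]; split=> //=; last exact: leqW.
move: aN; rewrite leq_eqVlt => /predU1P[aE|//].
by move: NA; rewrite -aE => /negP[]; exact/mem_set.
Qed.

(** $A(x)/x$ is the average up to the integer part of $x$, times a factor that
    tends to 1. *)
Lemma density_of_averages A (alpha : R) : pos_set A ->
  (\sum_(n < N) \1_A n.+1) / N%:R @[N --> \oo] --> alpha ->
  has_asymptotic_density A alpha.
Proof.
move=> A0 H; rewrite /has_asymptotic_density.
have truncy : Num.truncn x @[x --> (+oo : set_system R)] --> \oo.
  move=> P [N _ NP].
  suff : \forall x \near (+oo : set_system R), P (Num.truncn x) by [].
  near=> x; apply: NP => /=.
  have x0 : 0 <= x by near: x; exact: nbhs_pinfty_ge.
  by rewrite truncn_ge_nat//; near: x; exact: nbhs_pinfty_ge.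
have H1 : (\sum_(n < Num.truncn x) \1_A n.+1) / (Num.truncn x)%:R @[x --> (+oo : set_system R)] --> alpha.
  exact: (cvg_comp _ _ truncy H).
have H2 : (Num.truncn x)%:R / x @[x --> (+oo : set_system R)] --> (1 : R).
  apply/cvgrPdist_le => e e0; near=> x.
  have x0 : 0 < x by near: x; exact: nbhs_pinfty_gt.
  have xe : e^-1 <= x by near: x; apply: nbhs_pinfty_ge; exact: num_real.
  have /andP[x1 x2] := truncn_itv (ltW x0).
  have -> : 1 - (Num.truncn x)%:R / x = (x - (Num.truncn x)%:R) / x.
    by rewrite mulrBl divff// gt_eqF.
  rewrite ger0_norm; last by rewrite divr_ge0 ?subr_ge0 ?(ltW x0).
  rewrite ler_pdivrMr//; apply: (@le_trans _ _ 1).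
    by move: x2; rewrite -natr1; lra.
  by rewrite -ler_pdivrMl// mulr1.
rewrite -[alpha]mulr1.
apply: cvg_trans (cvgM H1 H2).
apply: near_eq_cvg; near=> x => /=.
have x1 : 1 <= x by near: x; exact: nbhs_pinfty_ge.
rewrite counting_fun_sum// mulrA divfK//.
by rewrite pnatr_eq0 -lt0n truncn_gt0.
Unshelve. all: by end_near. Qed.

End density.

Theorem theorem7 (R : realType) (A : set nat) (alpha : R)
    (A_pos : forall a : nat, A a -> (0 < a)%N)
    (A_inf : infinite_set A)
    (A_gcd : is_gcd_of_set A 1)
    (alpha_gt0 : 0 < alpha)
    (log_pA : asymp_equiv (fun n : nat => ln ((partition_fun A n)%:R : R))
                          (fun n : nat => c0 R * Num.sqrt (alpha * n%:R))) :
  has_asymptotic_density A alpha.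
Proof.
pose b : R := pi * Num.sqrt (alpha / 6).
have pi0 : 0 < pi :> R := pi_gt0 R.
have b0 : 0 < b by rewrite mulr_gt0// sqrtr_gt0 divr_gt0.
have bE : b ^+ 2 = alpha * (pi ^+ 2 / 6).
  by rewrite exprMn sqr_sqrtr ?divr_ge0 ?(ltW alpha_gt0)// mulrCA mulrA mulrAC mulrA.
have logA : ln ((partition_fun A n)%:R : R) / (2 * b * Num.sqrt n%:R) @[n --> \oo] --> (1 : R).
  have := log_pA; rewrite /asymp_equiv.
  under eq_fun => n.
    have -> : c0 R * Num.sqrt (alpha * n%:R) = 2 * b * Num.sqrt n%:R.
      have sqrt4 : Num.sqrt 4 = 2 :> R.
        by rewrite -[4]/(2 * 2)%:R natrM -expr2 sqrtr_sqr ger0_norm.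
      have sqrtE : Num.sqrt (2 / 3) * Num.sqrt alpha = 2 * Num.sqrt (alpha / 6).
        by rewrite -[in RHS]sqrt4 -!sqrtrM//; congr Num.sqrt; field.
      rewrite /c0 /b [Num.sqrt (alpha * _)]sqrtrM ?(ltW alpha_gt0)//.
      by rewrite [2 * (_ * _)]mulrCA -sqrtE !mulrA.
    over.
  exact.
pose w n : R := \1_A n.+1 - alpha.
have ind1 n : `|\1_A n.+1 : R| <= 1.
  by rewrite indicE ger0_norm ?lern1 ?ler_n0n ?leq_b1.
have wC n : `|w n| <= 1 + alpha.
  by apply: le_trans (ler_normB _ _) _; rewrite (gtr0_norm alpha_gt0) lerD2r ind1.
have C0 : 0 < 1 + alpha by rewrite addr_gt0.
have log_factor_w t : 0 < t ->
    dilate_series log_factor w t = dilate_series log_factor (fun n => \1_A n.+1) t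
      - alpha * dilate_series log_factor (fun=> 1) t.
  move=> t0; apply: cvg_lim => //.
  have -> : dilate_sum log_factor w t = (fun m => dilate_sum log_factor (fun n => \1_A n.+1) t m
      - alpha * dilate_sum log_factor (fun=> 1) t m).
    apply/funext => m; rewrite /dilate_sum mulr_sumr -sumrB; apply: eq_bigr => n _.
    by rewrite /w mul1r mulrBl.
  apply: cvgB; first exact: is_cvg_dilate_log_factor ind1.
  by apply: cvgMl_tmp; apply: (@is_cvg_dilate_log_factor _ _ _ 1) => // n; rewrite normr1.
have tlog_factor_w : t * dilate_series log_factor w t @[t --> (0 : R)^'+] --> (0 : R).
  have lim1 : alpha * (t * dilate_series log_factor (fun=> 1) t) @[t --> (0 : R)^'+] -->
      alpha * (pi ^+ 2 / 6).
    by apply: cvgMl_tmp; exact: scaled_log_factor1.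
  have limd : t * dilate_series log_factor (fun n => \1_A n.+1) t
      - alpha * (t * dilate_series log_factor (fun=> 1) t)
      @[t --> (0 : R)^'+] --> (0 : R).
    rewrite -[X in _ --> X](subrr (b ^+ 2)) [X in _ - X]bE; apply: cvgB => //.
    exact: log_partition_abelian.
  move: limd; apply: cvg_trans; apply: near_eq_cvg; near=> t => /=.
  rewrite log_factor_w; last by near: t; exact: nbhs_right_gt.
  by rewrite mulrBr mulrCA.
have avg_w := bounded_tauber C0 wC (laplace_of_log_kernel C0 wC tlog_factor_w).
apply: density_of_averages => //.
have avg : (\sum_(n < N) w n) / N%:R + alpha @[N --> \oo] --> alpha.
  by rewrite -[X in _ --> X]add0r; apply: cvgD => //; exact: cvg_cst.
apply: cvg_trans avg; apply: near_eq_cvg; near=> N => /=.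
have N0 : N%:R != 0 :> R.
  by rewrite pnatr_eq0 -lt0n; near: N; exact: nbhs_infty_gt.
rewrite /w sumrB sumr_const card_ord mulrBl -[alpha *+ N]mulr_natr mulfK//.
by rewrite subrK.
Unshelve. all: by end_near. Qed.
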